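(* Let $\mathbb{K}$ be a field of characteristic zero, let $\sigma\subset\mathbb{R}^n$ be a strongly convex rational cone containing the first orthant ${\mathbb{R}_{\ge0}}^n$, and let $\xi\in\mathbb{K}[[\sigma]]_{x_1\cdots x_n}\setminus\mathbb{K}[[x]]_{x_1\cdots x_n}$ be algebraic over $\mathbb{K}[[x]]$. Let $\omega=(\omega_1,\dots,\omega_n)$ be in the interior of the dual cone $\sigma^\vee$. Expand $\xi$ as $$\xi=\sum_{i\in\mathbb{Z}_{\ge0}}\xi_{k(i)}$$ where i) for every $k\in\Gamma=\mathbb{Z}\omega_1+\cdots+\mathbb{Z}\omega_n$, $\xi_k$ is the (finite) sum of the monomials $cx^\alpha$ of $\xi$ with $\omega\cdot\alpha=k$; ii) $(k(i))_{i\in\mathbb{Z}_{\geq 0}}$ is a strictly increasing sequence of elements of $\Gamma$; iii) $\xi_{k(i)}\neq0$ for every integer $i\ge 0$. Then there exists a constant $C>0$ such that $$k(i+1)\le k(i)+C\qquad\forall i\in\mathbb{Z}_{\ge0}.$$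
   Context: A (polyhedral) cone in $\mathbb{R}^n$ is the set of nonnegative real combinations of finitely many vectors; it is rational if the generators can be chosen in $\mathbb{Z}^n$, and strongly convex if it contains no nonzero linear subspace. The dual of $\sigma$ is $\sigma^\vee=\{v\in\mathbb{R}^n : v\cdot u\ge0\ \forall u\in\sigma\}$. $x=(x_1,\dots,x_n)$. A Laurent series is a formal sum $\xi=\sum_{\alpha\in\mathbb{Z}^n}\xi_\alpha x^\alpha$ with $\xi_\alpha\in\mathbb{K}$ and $\operatorname{Supp}(\xi)=\{\alpha : \xi_\alpha\neq0\}$. For a strongly convex rational cone $\sigma$, $\mathbb{K}[[\sigma]]$ is the ring of Laurent series with support in $\sigma\cap\mathbb{Z}^n$ (Cauchy product). If $\sigma\supset{\mathbb{R}_{\ge0}}^n$, $\mathbb{K}[[\sigma]]_{x_1\cdots x_n}$ is the localization by the powers of $x_1\cdots x_n$, i.e. the ring of Laurent series with support in $\gamma+\sigma$ for some $\gamma\in\mathbb{Z}^n$; $\mathbb{K}[[x]]_{x_1\cdots x_n}$ is the case $\sigma={\mathbb{R}_{\ge0}}^n$. ''Algebraic over $\mathbb{K}[[x]]$'' means: root of a nonzero polynomial with coefficients in $\mathbb{K}[[x]]$. *)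

(* Defs.v *)
From HB Require Import structures.
From mathcomp Require Import all_boot all_order all_algebra.
From mathcomp Require Import all_classical all_reals all_analysis.

Set Implicit Arguments.
Unset Strict Implicit.
Unset Printing Implicit Defensive.

Import Order.TTheory GRing.Theory Num.Theory.
Import numFieldNormedType.Exports.
Local Open Scope classical_set_scope.
Local Open Scope ring_scope.

Section Cones.
Context {R : realType} {n : nat}.
Implicit Types (u v omega : 'rV[R]_n) (alpha : 'rV[int]_n).
Implicit Types (sigma : set 'rV[R]_n).

Definition dot u v : R := \sum_(i < n) u 0 i * v 0 i.

Definition int_vec alpha : 'rV[R]_n := map_mx (intr : int -> R) alpha.

Definition cone_gen m (g : 'I_m -> 'rV[R]_n) : set 'rV[R]_n :=
  [set v | exists2 c : 'I_m -> R,
     (forall i, 0 <= c i) & v = \sum_(i < m) c i *: g i].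

Definition rational_cone sigma : Prop :=
  exists (m : nat) (g : 'I_m -> 'rV[int]_n),
    sigma = cone_gen (fun i => int_vec (g i)).

Definition strongly_convex sigma : Prop :=
  forall V : {vspace 'rV[R]_n}, [set` V] `<=` sigma -> V = 0%VS.

Definition orthant : set 'rV[R]_n := [set v | forall i, 0 <= v 0 i].

Definition dual_cone sigma : set 'rV[R]_n :=
  [set v | forall u, sigma u -> 0 <= dot v u].

Definition weight_group omega : set R :=
  [set k | exists alpha : 'rV[int]_n, k = dot omega (int_vec alpha)].

End Cones.

Arguments orthant R n : clear implicits.

(* Formal sums: xi alpha is the coefficient of x ^ alpha. *)
Definition laurent (K : fieldType) (n : nat) : Type := 'rV[int]_n -> K.

Section Laurent.
Context {K : fieldType} {n : nat}.
Implicit Types (xi f g : laurent K n).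

Definition supp xi : set 'rV[int]_n := [set alpha | xi alpha != 0].

(* The sum is over the finitely many beta giving a nonzero term; it has the
   junk value 0 if there are infinitely many, which does not happen when f
   and g are supported in translates of one strongly convex cone. *)
Definition lmul f g : laurent K n :=
  fun alpha => \sum_(beta \in [set: 'rV[int]_n]) (f beta * g (alpha - beta)).

Definition lone : laurent K n := fun alpha => (alpha == 0)%:R.

Definition lexp xi (j : nat) : laurent K n := iter j (lmul xi) lone.

(* P evaluated at xi, where P j is the coefficient of degree j. *)
Definition leval d (P : 'I_d -> laurent K n) xi : laurent K n :=
  fun alpha => \sum_(j < d) lmul (P j) (lexp xi j) alpha.

Section Supports.
Context {R : realType}.
Implicit Types (sigma : set 'rV[R]_n) (omega : 'rV[R]_n).

Definition cone_series sigma : set (laurent K n) :=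
  [set xi | forall alpha, supp xi alpha -> sigma (int_vec alpha)].

(* For sigma containing the orthant, the series supported in a translate of
   sigma are exactly the localization K[[sigma]]_{x_1 ... x_n}. *)
Definition cone_series_loc sigma : set (laurent K n) :=
  [set xi | exists gamma : 'rV[int]_n,
     forall alpha, supp xi alpha -> sigma (int_vec (alpha - gamma))].

Definition weight_part omega xi (k : R) : laurent K n :=
  fun alpha => if dot omega (int_vec alpha) == k then xi alpha else 0.

(* The sum over i is finite at each alpha: as k is injective, at most one
   term is nonzero. *)
Definition weight_expansion omega xi (k : nat -> R) : Prop :=
  [/\ forall alpha, xi alpha =
        \sum_(i \in [set: nat]) weight_part omega xi (k i) alpha,
      forall i, weight_group omega (k i),
      forall i j, (i < j)%N -> k i < k j &
      forall i, exists alpha, weight_part omega xi (k i) alpha != 0].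

End Supports.

Definition algebraic_over_power_series (R : realType) xi : Prop :=
  exists (d : nat) (P : 'I_d -> laurent K n),
    [/\ forall j, cone_series (orthant R n) (P j),
        exists j alpha, P j alpha != 0 &
        forall alpha, leval P xi alpha = 0].

End Laurent.

(* Main.v *)
Require Import Defs.
From HB Require Import structures.
From mathcomp Require Import all_boot all_order all_algebra.
From mathcomp Require Import all_classical all_reals all_analysis.
From mathcomp Require Import ring zify.
From mathcomp Require Import lra.

(** Only linear information about xi is needed. With D = sum_i lam_i x_i d/dx_i
    for an integer vector lam inside the dual cone, some nontrivial relation
    sum_k A_k D^k xi = 0 holds with power series A_k: for P minimal with
    P(xi) = 0, all D^k xi lie in a module of rank deg P over K[[x]], localized.
    Write chi_d = sum_k (A_k)_d T^k. If a pair (a, d) with a in Supp xi and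
    chi_d != 0 is the only one with sum a + d, then lam.a is a root of chi_d.
    When d is minimal for the componentwise order this leaves finitely many
    "exceptional" a, by Dickson's lemma.
    Choosing extremal pairs then shows: if Supp xi has finitely many elements
    below each omega-level (omega positive), then omega attains its minimum over
    Supp xi on the exceptional set, and the same finiteness persists near omega.
    Since xi is not in K[[x]]_x, moving omega inside the open orthant reaches a
    positive omega0 that is bounded below on Supp xi but has an infinite level.
    There is then a narrow omega0-window with infinitely many points of the
    support, which interact only with the omega0-lowest face of the operator;
    this face is finite, and its omega-width bounds the gaps that are far out:
    the first point of the window after a longer gap would be half of an
    extremal pair. *)

Set Implicit Arguments.
Unset Strict Implicit.
Unset Printing Implicit Defensive.

Import Order.TTheory GRing.Theory Num.Theory.
Import numFieldNormedType.Exports.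
Local Open Scope classical_set_scope.
Local Open Scope ring_scope.

(** * Linear differential equations for algebraic elements *)

Section LinearDependence.
Context {A : idomainType} (S : subringClosed A).

(** Gaussian elimination without fractions: multiplying by pivots instead of dividing keeps the
    coefficients in [S]. *)
Lemma subring_linear_dependence d (v : 'I_d.+1 -> nat -> A) :
  (forall i j, v i j \in S) ->
  exists c : 'I_d.+1 -> A,
    [/\ forall i, c i \in S, exists i, c i != 0 &
        forall j, (j < d)%N -> \sum_(i < d.+1) c i * v i j = 0].
Proof.
elim: d v => [|d IHd] v Sv.
  exists (fun=> 1); split=> //; first by move=> i; exact: rpred1.
  by exists ord0; exact: oner_neq0.
have [p vp | v0] := pickP (fun i => v i d != 0); last first.
  have [|c [Sc [i ci] cv]] := IHd (fun i => v (lift ord0 i)).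
    by move=> i j; exact: Sv.
  exists (fun i => if unlift ord0 i is Some i' then c i' else 0).
  split=> [i'||j].
  - by case: unliftP => [k _|_]; [exact: Sc | exact: rpred0].
  - by exists (lift ord0 i); rewrite liftK.
  rewrite ltnS leq_eqVlt => /orP[/eqP ->|jd].
    by apply: big1 => k _; move/negbFE/eqP: (v0 k) => ->; rewrite mulr0.
  rewrite big_ord_recl unlift_none mul0r add0r -[RHS](cv _ jd).
  by apply: eq_bigr => k _; rewrite liftK.
have [|c [Sc [i ci] cv]] :=
  IHd (fun i j => v p d * v (lift p i) j - v (lift p i) d * v p j).
  by move=> i j; rewrite rpredB ?rpredM.
(* The coefficient of the pivot row [p] is the one that cancels column [d]; earlier columns vanish
   by the choice of [c]. *)
exists (fun i => if unlift p i is Some i' then c i' * v p d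
                 else - \sum_(k < d.+1) c k * v (lift p k) d).
split=> [i'||j].
- case: unliftP => [k _|_]; first by rewrite rpredM.
  by rewrite rpredN rpred_sum // => k _; rewrite rpredM.
- by exists (lift p i); rewrite liftK mulf_neq0.
rewrite ltnS leq_eqVlt (bigD1_ord p) //= unlift_none.
rewrite [X in _ + X](eq_bigr (fun i => c i * v p d * v (lift p i) j)); last first.
  by move=> k _; rewrite liftK.
case/orP=> [/eqP ->|jd].
  apply/eqP; rewrite mulNr addrC subr_eq0; apply/eqP.
  by rewrite mulr_suml; apply: eq_bigr => k _; ring.
rewrite mulNr addrC mulr_suml -sumrB -[RHS](cv _ jd).
by apply: eq_bigr => k _; ring.
Qed.

End LinearDependence.

Section Derivation.
Context {A : idomainType} (S : subringClosed A) (D : {additive A -> A}).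
Hypothesis DM : forall x y, D (x * y) = D x * y + x * D y.
Hypothesis SD : forall x, x \in S -> D x \in S.

Lemma derivation1 : D 1 = 0.
Proof.
by apply/(addrI (D 1)); rewrite addr0 -[in RHS](mulr1 1) DM mulr1 mul1r.
Qed.

Lemma derivationX x n : D (x ^+ n) = x ^+ n.-1 * D x *+ n.
Proof.
elim: n => [|[|n] IHn]; first by rewrite expr0 derivation1.
  by rewrite expr1 expr0 mul1r.
rewrite exprS DM IHn /= -mulrnAr mulrA -exprS -mulrnAr.
by rewrite [D x * _]mulrC -mulrDr [in RHS]mulrS.
Qed.

Lemma derivation_horner (r : {poly A}) x :
  D r.[x] = (map_poly D r).[x] + r^`().[x] * D x.
Proof.
elim/poly_ind: r => [|r c IHr].
  by rewrite map_poly0 deriv0 !horner0 raddf0 mul0r addr0.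
have -> : map_poly D (r * 'X + c%:P) = map_poly D r * 'X + (D c)%:P.
  apply/polyP => i; rewrite coef_map /= !coefD !coefMX !coefC raddfD /=.
  by case: i => [|i]; rewrite ?raddf0 // coef_map.
rewrite derivMXaddC !hornerMXaddC hornerD hornerMX raddfD DM /= IHr.
by ring.
Qed.

Lemma polyOver_map_derivation (r : {poly A}) :
  r \is a polyOver S -> map_poly D r \is a polyOver S.
Proof. by move/polyOverP=> Sr; apply/polyOverP=> i; rewrite coef_map /= SD. Qed.

(** The leading coefficient of [p] need not be invertible, hence its powers. At a root of [p] the
    quotient drops out. *)
Lemma polyOver_pseudo_division (p r : {poly A}) :
  p \is a polyOver S -> p != 0 -> r \is a polyOver S ->
  exists (c : nat) (s : {poly A}),
    [/\ s \is a polyOver S, (size s < size p)%N &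
        forall x, root p x -> lead_coef p ^+ c * r.[x] = s.[x]].
Proof.
move=> Sp p0; have [m] := ubnP (size r); elim: m r => // m IHm r.
rewrite ltnS => rm Sr; have [rp|pr] := ltnP (size r) (size p).
  by exists 0%N, r; split=> // x _; rewrite expr0 mul1r.
have p_gt0 : (0 < size p)%N by rewrite size_poly_gt0.
have r_gt0 := leq_trans p_gt0 pr.
pose r' := lead_coef p *: r - lead_coef r *: 'X^(size r - size p) * p.
have Sl (q : {poly A}) : q \is a polyOver S -> lead_coef q \in S.
  by move/polyOverP; exact.
have Sr' : r' \is a polyOver S.
  by rewrite rpredB ?rpredM ?polyOverZ ?Sl // rpredX // polyOverX.
have r'r : (size r' < size r)%N.
  rewrite -(prednK r_gt0) ltnS; apply/leq_sizeP => j.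
  rewrite leq_eqVlt coefB coefZ -scalerAl coefZ coefXnM.
  case/orP=> [/eqP <-|jr].
    have -> : ((size r).-1 < size r - size p)%N = false by lia.
    have -> : ((size r).-1 - (size r - size p) = (size p).-1)%N by lia.
    by rewrite /lead_coef mulrC subrr.
  have rj : (size r <= j)%N by rewrite -(prednK r_gt0).
  rewrite [r`_j]nth_default // mulr0 sub0r; case: ltnP => [_|jrp].
    by rewrite mulr0 oppr0.
  rewrite [p`__]nth_default ?mulr0 ?oppr0 //.
  by rewrite leq_subRL // addnC subnKC.
have [c [s [Ss sp Es]]] := IHm r' (leq_trans r'r rm) Sr'.
exists c.+1, s; split=> // x px; rewrite -Es // exprSr -mulrA; congr (_ * _).
by rewrite hornerD hornerN hornerM (rootP px) mulr0 subr0 hornerZ.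
Qed.

(** Let [q] be the derivative of [p] evaluated at [x]. Applying [D] to [p.[x] = 0] shows that
    [q * D x] is a polynomial in [x] over [S], so each further derivation costs only powers of
    [q]. *)
Lemma separable_derivation_iter (p : {poly A}) x k :
  p \is a polyOver S -> root p x ->
  exists N (r : {poly A}),
    r \is a polyOver S /\ p^`().[x] ^+ N * iter k D x = r.[x].
Proof.
move=> Sp px; set q := p^`().[x].
have Sp' : p^`() \is a polyOver S by rewrite polyOver_deriv.
have qDx : q * D x = - (map_poly D p).[x].
  have := derivation_horner p x; rewrite (rootP px) raddf0.
  by move/esym/eqP; rewrite addrC addr_eq0 => /eqP.
elim: k => [|k [N [r [Sr Er]]]].
  by exists 0%N, 'X; rewrite polyOverX expr0 mul1r hornerX.
pose u := p^`() * map_poly D p^`() - p^`()^`() * map_poly D p.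
have Su : u \is a polyOver S.
  by rewrite rpredB ?rpredM ?polyOver_deriv ?polyOver_map_derivation.
have Eu : u.[x] = q * D q.
  rewrite derivation_horner !hornerE -/q mulrDr; congr (_ + _).
  by rewrite mulrCA qDx mulrN.
move: u Su Eu => u Su Eu.
(* One new factor [q] clears [D x] from the derivative of [r.[x]]; the other turns the [D q] coming
   from [q ^+ N] into [u.[x]]. *)
exists N.+2, (p^`() * (p^`() * map_poly D r - r^`() * map_poly D p) - u * r *+ N).
split.
  by rewrite rpredB ?rpredMn ?rpredM ?rpredB ?rpredM ?polyOver_deriv //
    polyOver_map_derivation.
have DEr := derivation_horner r x.
rewrite -Er DM derivationX in DEr.
rewrite iterS !(hornerMn, hornerE) -/q Eu -Er.
have -> : (map_poly D r).[x] =
    q ^+ N.-1 * D q *+ N * iter k D x + q ^+ N * D (iter k D x)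
    - r^`().[x] * D x.
  by rewrite DEr addrK.
move: qDx; set z := (map_poly D p).[x] => qDx.
have {qDx} -> : z = - (q * D x) by rewrite qDx opprK.
case: N {Er DEr} => [|N] /=.
  by rewrite !mulr0n !expr0; ring.
by rewrite !exprS; ring.
Qed.

Lemma uniform_exponent (P : nat -> nat -> Prop) d :
  (forall k N, P k N -> P k N.+1) -> (forall k, exists N, P k N) ->
  exists N, forall k, (k < d)%N -> P k N.
Proof.
move=> Pmono Pex.
have Ple k N N' : (N <= N')%N -> P k N -> P k N'.
  by move=> /subnKC <-; elim: (N' - N)%N => [|j IHj]; rewrite ?addn0 // addnS; auto.
elim: d => [|d [N PN]]; first by exists 0%N.
have [N' PN'] := Pex d; exists (maxn N N') => k.
rewrite ltnS leq_eqVlt => /orP[/eqP ->|kd].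
  exact: Ple (leq_maxr _ _) PN'.
exact: Ple (leq_maxl _ _) (PN _ kd).
Qed.

(** If the derivative of [p] also vanishes at [x], it replaces [p]. Otherwise, with [d] the degree
    of [p], clearing powers of [q] and of the leading coefficient turns the first [d.+1] iterates of
    [D] at [x] into polynomials in [x] of degree below [d], which are linearly dependent over
    [S]. *)
Lemma algebraic_linear_ode (p : {poly A}) x :
  (forall n, n.+1%:R != 0 :> A) ->
  p \is a polyOver S -> p != 0 -> root p x ->
  exists m (a : 'I_m -> A),
    [/\ forall k, a k \in S, exists k, a k != 0 &
        \sum_(k < m) a k * iter k D x = 0].
Proof.
move=> char0; have [b] := ubnP (size p); elim: b p => // b IHb p.
rewrite ltnS => pb Sp p0 px.
have size_p := root_size_gt1 p0 px.
have p'0 : p^`() != 0.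
  apply/eqP => /polyP/(_ (size p).-2); rewrite coef_deriv coef0 => /eqP.
  have -> : (size p).-2.+1 = (size p).-1 by case: (size p) size_p => [|[]].
  rewrite -mulr_natr mulf_eq0 -/(lead_coef p) lead_coef_eq0 (negPf p0) /=.
  by case: (size p) size_p => [|[|n]] //= _; rewrite (negPf (char0 _)).
have Sp' : p^`() \is a polyOver S by rewrite polyOver_deriv.
have [p'x|] := boolP (root p^`() x).
  exact: IHb (leq_trans (lt_size_deriv p0) pb) Sp' p'0 p'x.
rewrite /root => q0; set q := p^`().[x] in q0; set l := lead_coef p.
have Sl : l \in S by move/polyOverP: Sp; exact.
have l0 : l != 0 by rewrite lead_coef_eq0.
pose d := (size p).-1.
have [|k|N EN] := @uniform_exponent (fun k N => exists r : {poly A},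
  r \is a polyOver S /\ q ^+ N * iter k D x = r.[x]) d.+1.
- move=> k N [r [Sr Er]]; exists (p^`() * r).
  by rewrite rpredM // hornerM -Er exprS mulrA.
- have [N [r Er]] := separable_derivation_iter k Sp px.
  by exists N, r.
have [|k|c Ec] := @uniform_exponent (fun k c => (k < d.+1)%N -> exists s : {poly A},
  [/\ s \is a polyOver S, (size s < size p)%N &
      l ^+ c * (q ^+ N * iter k D x) = s.[x]]) d.+1.
- move=> k c Pc /Pc [s [Ss sp Es]]; exists (l *: s); split.
  + exact: polyOverZ Sl Ss.
  + exact: leq_ltn_trans (size_scale_leq _ _) sp.
  + by rewrite hornerZ -Es exprS -mulrA.
- have [kd|kd] := ltnP k d.+1; last by exists 0%N.
  have [r [Sr Er]] := EN _ kd.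
  have [c [s [Ss sp Es]]] := polyOver_pseudo_division Sp p0 Sr.
  by exists c => _; exists s; split=> //; rewrite Er Es.
have /fin_all_exists[s Es] (i : 'I_d.+1) : exists s : {poly A},
    [/\ s \is a polyOver S, (size s < size p)%N &
        l ^+ c * (q ^+ N * iter i D x) = s.[x]].
  exact: Ec.
have [|a [Sa a0 Ea]] := @subring_linear_dependence _ S d (fun i j => (s i)`_j).
  by move=> i j; have [/polyOverP Ss _ _] := Es i; exact: Ss.
exists d.+1, a; split=> //.
apply/eqP.
have : l ^+ c * q ^+ N * (\sum_(k < d.+1) a k * iter k D x) = 0.
  transitivity (\sum_(i < d.+1) a i *: s i).[x].
    rewrite horner_sum mulr_sumr; apply: eq_bigr => i _.
    by have [_ _ Ei] := Es i; rewrite hornerZ -Ei mulrCA !mulrA.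
  suff -> : \sum_(i < d.+1) a i *: s i = 0 by rewrite horner0.
  apply/polyP => j; rewrite coef_sum coef0.
  under eq_bigr do rewrite coefZ.
  have [/Ea //|dj] := ltnP j d.
  apply: big1 => i _; rewrite nth_default ?mulr0 //.
  have [_ si _] := Es i; apply: leq_trans dj.
  by rewrite -ltnS (leq_trans si) // leqSpred.
by move/eqP; rewrite !mulf_eq0 !expf_eq0 (negPf l0) (negPf q0) !andbF.
Qed.

End Derivation.

(** * Weights of integer vectors *)

Lemma finite_argmin {disp} {T : choiceType} {O : orderType disp}
    (A : set T) (u : T -> O) :
  finite_set A -> A !=set0 -> exists2 x, A x & forall y, A y -> (u x <= u y)%O.
Proof.
move=> /finite_seqP[s ->]; elim: s => [[x]//|a s IHs _].
have [->|s0] := eqVneq s [::].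
  by exists a => /= [|y]; rewrite inE // => /eqP ->.
have [|x xs xmin] := IHs.
  by case: s s0 {IHs} => // b s _; exists b; rewrite /= mem_head.
have [ax|xa] := leP (u a) (u x).
  exists a => /= [|y]; first by rewrite mem_head.
  rewrite inE => /orP[/eqP ->//|ys]; exact: le_trans (xmin _ ys).
exists x => /= [|y]; first by rewrite inE xs orbT.
by rewrite inE => /orP[/eqP ->|ys]; [exact: ltW | exact: xmin].
Qed.

Lemma finite_lower_bound {T : choiceType} {R : realType} (A : set T)
    (u : T -> R) : finite_set A -> exists c, forall x, A x -> c <= u x.
Proof.
move=> finA; have [[x Ax]|A0] := pselect (A !=set0).
  by have [y _ ymin] := finite_argmin u finA (ex_intro _ x Ax); exists (u y).
by exists 0 => x Ax; case: A0; exists x.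
Qed.

(* Maximize |a + b|^2: another decomposition a' + b' would make one of
   a' + b and a + b' longer, by the parallelogram identity. *)
Lemma unique_sum {n} (A B : set 'rV[int]_n) :
  finite_set A -> finite_set B -> A !=set0 -> B !=set0 ->
  exists a b, [/\ A a, B b &
    forall a' b', A a' -> B b' -> a' + b' = a + b -> a' = a /\ b' = b].
Proof.
move=> finA finB [a0 Aa0] [b0 Bb0].
pose sq (v : 'rV[int]_n) : int := \sum_i v 0 i ^+ 2.
have [|[a b] [/= Aa Bb] abmax] :=
  finite_argmin (fun p : 'rV[int]_n * 'rV[int]_n => - sq (p.1 + p.2))
    (finite_setX finA finB); first by exists (a0, b0).
exists a, b; split=> // a' b' Aa' Bb' eq_ab.
have maxE x y : A x -> B y -> sq (x + y) <= sq (a + b).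
  by move=> Ax By; have /= := abmax (x, y) (conj Ax By); rewrite lerN2.
have [v Ea'] : exists v, a' = a + v by exists (a' - a); rewrite addrC subrK.
have Eb' : b' = b - v.
  by apply: (addrI a'); rewrite eq_ab Ea' addrACA subrr addr0.
have sq2 : sq (a' + b) + sq (a + b') = sq (a + b) *+ 2 + sq v *+ 2.
  rewrite Ea' Eb' /sq -!sumrMnl -!big_split /=; apply: eq_bigr => i _.
  by rewrite !mxE; ring.
have sqv : sq v <= 0.
  have := lerD (maxE _ _ Aa' Bb) (maxE _ _ Aa Bb'); rewrite sq2.
  by move: (sq v) (sq (a + b)) => x y; lia.
have v0 : v = 0.
  apply/rowP => i; rewrite mxE; apply/eqP; rewrite -sqrf_eq0 eq_le sqr_ge0 andbT.
  apply: le_trans sqv; rewrite /sq (bigD1 i) //= lerDl.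
  by apply: sumr_ge0 => j _; exact: sqr_ge0.
by rewrite Ea' Eb' v0 addr0 subr0.
Qed.

Definition wt {R : realType} {n} (omega : 'rV[R]_n) (alpha : 'rV[int]_n) : R :=
  dot omega (int_vec alpha).

Section Weight.
Context {R : realType} {n : nat}.
Implicit Types (omega rho : 'rV[R]_n) (a b : 'rV[int]_n).

Lemma wtE omega a : wt omega a = \sum_i omega 0 i * (a 0 i)%:~R.
Proof. by rewrite /wt /dot; apply: eq_bigr => i _; rewrite mxE. Qed.

Lemma wtD omega a b : wt omega (a + b) = wt omega a + wt omega b.
Proof.
rewrite !wtE -big_split; apply: eq_bigr => i _.
by rewrite mxE intrD mulrDr.
Qed.

Lemma wtN omega a : wt omega (- a) = - wt omega a.
Proof.
by rewrite !wtE -sumrN; apply: eq_bigr => i _; rewrite mxE intrN mulrN.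
Qed.

Lemma wtB omega a b : wt omega (a - b) = wt omega a - wt omega b.
Proof. by rewrite wtD wtN. Qed.

Lemma wtDl omega rho a : wt (omega + rho) a = wt omega a + wt rho a.
Proof.
by rewrite !wtE -big_split; apply: eq_bigr => i _; rewrite mxE mulrDl.
Qed.

Lemma wtZl (c : R) omega a : wt (c *: omega) a = c * wt omega a.
Proof. by rewrite !wtE mulr_sumr; apply: eq_bigr => i _; rewrite mxE mulrA. Qed.

End Weight.

Section FiniteBelow.
Context {R : realType} {n : nat} (omega : 'rV[R]_n).
Implicit Types (A B : set 'rV[int]_n).

(** This makes Cauchy products finite sums and is inherited by them. It involves no cone, so the
    weight can vary while the set stays fixed. *)
Definition finite_below A : Prop :=
  forall t, finite_set [set a | A a /\ wt omega a <= t].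

Lemma finite_below_sub A B : A `<=` B -> finite_below B -> finite_below A.
Proof. by move=> AB finB t; apply: sub_finite_set (finB t) => a [/AB]. Qed.

Lemma finite_belowU A B :
  finite_below A -> finite_below B -> finite_below (A `|` B).
Proof.
move=> finA finB t; apply: (@sub_finite_set _ _
  ([set a | A a /\ wt omega a <= t] `|` [set a | B a /\ wt omega a <= t])).
  by move=> a [[Aa|Ba] ?]; [left | right].
by rewrite finite_setU.
Qed.

Lemma finite_below_lower A :
  finite_below A -> exists c, forall a, A a -> c <= wt omega a.
Proof.
move=> finA; have [c cP] := finite_lower_bound (wt omega) (finA 0).
exists (Num.min c 0) => a Aa; have [a0|a0] := leP (wt omega a) 0.
  by rewrite ge_min cP.
by rewrite ge_min (ltW a0) orbT.
Qed.

Lemma finite_below_add A B : finite_below A -> finite_below B ->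
  finite_below [set c | exists a b, [/\ A a, B b & c = a + b]].
Proof.
move=> finA finB t.
have [ca caP] := finite_below_lower finA; have [cb cbP] := finite_below_lower finB.
have finAB := finite_setX (finA (t - cb)) (finB (t - ca)).
apply: sub_finite_set (finite_image (fun p => p.1 + p.2) finAB).
move=> _ [[a [b [Aa Bb ->]]]]; rewrite wtD => abt.
have := caP _ Aa; have := cbP _ Bb => cbb caa.
by exists (a, b) => //; split; split=> //=; lra.
Qed.

Lemma finite_below_argmin A : finite_below A -> A !=set0 ->
  exists2 a, A a & forall b, A b -> wt omega a <= wt omega b.
Proof.
move=> finA [a0 Aa0].
have [|a [Aa _] amin] := finite_argmin (wt omega) (finA (wt omega a0)).
  by exists a0.
exists a => // b Ab; have [ba0|/ltW ba0] := leP (wt omega b) (wt omega a0).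
  exact: amin.
by apply: le_trans ba0; apply: amin.
Qed.

End FiniteBelow.

(** * Series with finitely many exponents below each weight *)

Section Series.
Context {R : realType} (K : fieldType) {n : nat} (omega : 'rV[R]_n).
Local Notation V := 'rV[int]_n.
Implicit Types (f g h : laurent K n) (a b c : V).

Lemma laddE f g a : (f + g : laurent K n) a = f a + g a. Proof. by []. Qed.

(** Any duplicate-free list containing the nonzero terms will do, so several products can be summed
    over one common list. *)
Lemma lmul_seq f g a (s : seq V) : uniq s ->
  (forall b, f b != 0 -> g (a - b) != 0 -> b \in s) ->
  lmul f g a = \sum_(b <- s) f b * g (a - b).
Proof.
move=> us sP; rewrite /lmul (@fsbigE _ _ _ _ _ s) //.
  by apply: eq_bigl => b; rewrite in_setT.
move=> b _ bs; apply/eqP; move: bs; apply: contraNT.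
by rewrite mulf_eq0 negb_or => /andP[]; exact: sP.
Qed.

Lemma lmul_neq0 f g a : lmul f g a != 0 -> exists b, f b != 0 /\ g (a - b) != 0.
Proof.
move=> fga; have [//|none] := pselect (exists b, f b != 0 /\ g (a - b) != 0).
case/eqP: fga; rewrite (@lmul_seq _ _ _ [::]) ?big_nil // => b fb gb.
by case: none; exists b.
Qed.

Lemma lmul_single f g a b :
  (forall b', f b' != 0 -> g (a - b') != 0 -> b' = b) ->
  lmul f g a = f b * g (a - b).
Proof.
move=> bP; rewrite (@lmul_seq _ _ _ [:: b]) ?big_seq1 // => b' fb gb.
by rewrite inE (bP b').
Qed.

Lemma supp_lmul f g :
  supp (lmul f g) `<=` [set c | exists a b, [/\ supp f a, supp g b & c = a + b]].
Proof.
move=> a /lmul_neq0[b [fb gb]]; exists b, (a - b); split=> //.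
by rewrite addrC subrK.
Qed.

Lemma finite_below_lmul f g :
  finite_below omega (supp f) -> finite_below omega (supp g) ->
  finite_below omega (supp (lmul f g)).
Proof.
by move=> ff fg; apply: finite_below_sub (@supp_lmul f g) (finite_below_add ff fg).
Qed.

Lemma finite_below_seq f t : finite_below omega (supp f) ->
  exists2 s : seq V, uniq s & forall a, f a != 0 -> wt omega a <= t -> a \in s.
Proof.
move=> /(_ t)/finite_seqP[s Es]; exists (undup s); first exact: undup_uniq.
move=> a fa at_; rewrite mem_undup.
by have : [set` s] a by rewrite -Es.
Qed.

Lemma finite_below_lmul_fun f g a :
  finite_below omega (supp f) -> finite_below omega (supp g) ->
  finite_set [set b | f b != 0 /\ g (a - b) != 0].
Proof.
move=> ff fg; have [c cP] := finite_below_lower fg.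
apply: sub_finite_set (ff (wt omega a - c)) => b [fb gb]; split=> //=.
by have := cP _ gb; rewrite wtB; lra.
Qed.

Lemma lmulC f g : lmul f g = lmul g f.
Proof.
apply/funext => a; rewrite /lmul (reindex_fsbigT (fun b => a - b)) /=.
  by apply: eq_fsbigr => b _; rewrite subKr mulrC.
by exists (fun b => a - b) => b; rewrite subKr.
Qed.

Lemma lmul1 f : lmul lone f = f.
Proof.
apply/funext => a; rewrite (@lmul_single _ _ _ 0).
  by rewrite /lone eqxx mul1r subr0.
by move=> b; rewrite /lone; case: (b =P 0) => [->|_] //=; rewrite eqxx.
Qed.

Lemma lmulDl f f' g :
  finite_below omega (supp f) -> finite_below omega (supp f') ->
  finite_below omega (supp g) -> lmul (f + f') g = lmul f g + lmul f' g.
Proof.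
move=> ff ff' fg; apply/funext => a.
have := finite_below_lmul_fun a ff fg; have := finite_below_lmul_fun a ff' fg.
move=> /finite_seqP[s Es] /finite_seqP[s' Es'].
have [u us uP] : exists2 u : seq V, uniq u & forall b, (b \in s) || (b \in s') -> b \in u.
  by exists (undup (s ++ s')) => [|b]; rewrite ?undup_uniq // mem_undup mem_cat.
have sP b : f' b != 0 -> g (a - b) != 0 -> b \in s.
  by move=> fb gb; have : [set` s] b by rewrite -Es.
have s'P b : f b != 0 -> g (a - b) != 0 -> b \in s'.
  by move=> fb gb; have : [set` s'] b by rewrite -Es'.
rewrite laddE !(@lmul_seq _ _ _ u) //.
- by rewrite -big_split; apply: eq_bigr => b _; rewrite laddE mulrDl.
- by move=> b fb gb; apply: uP; rewrite sP.
- by move=> b fb gb; apply: uP; rewrite s'P ?orbT.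
move=> b fb gb; apply: uP; have [fb0|fb0] := eqVneq (f b) 0.
  by rewrite sP //; move: fb; rewrite laddE fb0 add0r.
by rewrite s'P ?orbT.
Qed.

(** Both sides are one double sum in two orders. With commutativity this yields associativity. *)
Lemma lmulCA f g h :
  finite_below omega (supp f) -> finite_below omega (supp g) ->
  finite_below omega (supp h) -> lmul f (lmul g h) = lmul g (lmul f h).
Proof.
move=> ff fg fh; apply/funext => a.
have [cf cfP] := finite_below_lower ff.
have [cg cgP] := finite_below_lower fg.
have [ch chP] := finite_below_lower fh.
have [s us sP] := finite_below_seq (wt omega a - cg - ch) ff.
have [u uu uP] := finite_below_seq (wt omega a - cf - ch) fg.
(* Discarding zeros makes membership in the list imply the lower bound on weights, which confines
   the other summation index. *)
have [s' us' s'P] : exists2 s' : seq V, uniq s' &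
    forall b, (b \in s') = (b \in s) && (f b != 0).
  by exists [seq b <- s | f b != 0] => [|b]; rewrite ?filter_uniq // mem_filter andbC.
have [u' uu' u'P] : exists2 u' : seq V, uniq u' &
    forall b, (b \in u') = (b \in u) && (g b != 0).
  by exists [seq b <- u | g b != 0] => [|b]; rewrite ?filter_uniq // mem_filter andbC.
have expand f1 g1 s1 u1 : uniq s1 -> uniq u1 ->
    (forall b c, f1 b != 0 -> g1 c != 0 -> h (a - b - c) != 0 -> b \in s1) ->
    (forall b c, b \in s1 -> g1 c != 0 -> h (a - b - c) != 0 -> c \in u1) ->
    lmul f1 (lmul g1 h) a =
    \sum_(b <- s1) \sum_(c <- u1) f1 b * (g1 c * h (a - b - c)).
  move=> us1 uu1 s1P u1P; rewrite (lmul_seq us1).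
    rewrite !big_seq; apply: eq_bigr => b bs.
    rewrite (lmul_seq uu1) ?mulr_sumr // => c gc hc; exact: u1P gc hc.
  by move=> b fb /lmul_neq0[c [gc hc]]; exact: s1P gc hc.
rewrite (@expand f g s' u') // ?(@expand g f u' s') //.
- rewrite exchange_big; apply: eq_bigr => c _; apply: eq_bigr => b _.
  by rewrite mulrCA -!addrA [- c - b]addrC.
- move=> b c gb fc hc; rewrite u'P gb andbT uP //.
  by have := cfP _ fc; have := chP _ hc; rewrite !wtB; lra.
- move=> b c; rewrite u'P => /andP[_ gb] fc hc; rewrite s'P fc andbT sP //.
  by have := cgP _ gb; have := chP _ hc; rewrite !wtB; lra.
- move=> b c fb gc hc; rewrite s'P fb andbT sP //.
  by have := cgP _ gc; have := chP _ hc; rewrite !wtB; lra.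
- move=> b c; rewrite s'P => /andP[_ fb] gc hc; rewrite u'P gc andbT uP //.
  by have := cfP _ fb; have := chP _ hc; rewrite !wtB; lra.
Qed.

(** Among the [omega]-lowest exponents of the two factors, [unique_sum] finds a sum attained once,
    where no cancellation can occur. *)
Lemma lmul_domain f g :
  finite_below omega (supp f) -> finite_below omega (supp g) ->
  supp f !=set0 -> supp g !=set0 -> supp (lmul f g) !=set0.
Proof.
move=> ff fg f0 g0.
have [a0 fa0 a0min] := finite_below_argmin ff f0.
have [b0 gb0 b0min] := finite_below_argmin fg g0.
have [||a [b [[fa aa0] [gb bb0] abP]]] :=
  unique_sum (ff (wt omega a0)) (fg (wt omega b0)).
- by exists a0.
- by exists b0.
exists (a + b); rewrite /supp /= (@lmul_single _ _ _ a).
  by rewrite addrC addKr mulf_neq0.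
move=> c fc gc; have [|||//] := abP c (a + b - c); last by rewrite addrC subrK.
- by split=> //=; have := b0min _ gc; rewrite wtB wtD; move: bb0 aa0 => /=; lra.
- by split=> //=; have := a0min _ fc; rewrite wtB wtD; move: bb0 aa0 => /=; lra.
Qed.

End Series.

(** * The integral domain of series with finitely many exponents below each weight *)

Section SeriesRing.
Context {R : realType} (K : fieldType) {n : nat} (omega : 'rV[R]_n).

Definition fb_pred : {pred 'rV[int]_n -> K} :=
  fun f => `[< finite_below omega (supp (f : laurent K n)) >].

Lemma fb_zmod_closed : zmod_closed fb_pred.
Proof.
split=> [|f g /asboolP ff /asboolP fg]; apply/asboolP.
  by move=> t; apply: (@sub_finite_set _ _ set0) => // a [/=]; rewrite /supp /= eqxx.
apply: finite_below_sub (finite_belowU ff fg) => a; rewrite /supp /=.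
have [f0|] := eqVneq (f a) 0; last by left.
have [g0|] := eqVneq (g a) 0; last by right.
have -> : (f - g) a = f a - g a by [].
by rewrite f0 g0 subr0 eqxx.
Qed.

HB.instance Definition _ := GRing.isZmodClosed.Build _ fb_pred fb_zmod_closed.

Record fbseries := FBSeries { fbval : 'rV[int]_n -> K; _ : fb_pred fbval }.
HB.instance Definition _ := [isSub for fbval].
HB.instance Definition _ := [Choice of fbseries by <:].
HB.instance Definition _ := [SubChoice_isSubZmodule of fbseries by <:].

Lemma fbvalP (f : fbseries) : finite_below omega (supp (fbval f : laurent K n)).
Proof. by case: f => f /= /asboolP. Qed.

Lemma fbval_inj : injective fbval.
Proof. exact: val_inj. Qed.

Definition to_fb (f : laurent K n) (ff : finite_below omega (supp f)) : fbseries :=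
  FBSeries (introT (asboolP _) ff).

Lemma finite_below_lone : finite_below omega (supp (lone : laurent K n)).
Proof.
move=> t; apply: (@sub_finite_set _ _ [set 0]) => // a [/= + _].
by rewrite /supp /= /lone; case: (a =P 0) => //=; rewrite eqxx.
Qed.

Definition fb_one : fbseries := to_fb finite_below_lone.
Definition fb_mul (f g : fbseries) : fbseries :=
  to_fb (finite_below_lmul (fbvalP f) (fbvalP g)).

Lemma fb_mulC : commutative fb_mul.
Proof. by move=> f g; apply: fbval_inj; exact: lmulC. Qed.

Lemma fb_mulA : associative fb_mul.
Proof.
move=> f g h; apply: fbval_inj; rewrite /=.
rewrite [RHS]lmulC [lmul (fbval g) _]lmulC.
by apply: lmulCA; exact: fbvalP.
Qed.

Lemma fb_mul1 : left_id fb_one fb_mul.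
Proof. by move=> f; apply: fbval_inj; exact: lmul1. Qed.

Lemma fb_mulDl : left_distributive fb_mul +%R.
Proof.
move=> f g h; apply: fbval_inj.
by apply: lmulDl; exact: fbvalP.
Qed.

Lemma fb_one_neq0 : fb_one != 0.
Proof.
apply/eqP => /(congr1 (fun f => fbval f 0)) /eqP.
by rewrite /= /lone eqxx oner_eq0.
Qed.

HB.instance Definition _ := GRing.Zmodule_isComNzRing.Build fbseries
  fb_mulA fb_mulC fb_mul1 fb_mulDl fb_one_neq0.

Lemma fbseries_neq0 (f : fbseries) : f != 0 -> supp (fbval f : laurent K n) !=set0.
Proof.
move=> f0; have [//|none] := pselect (supp (fbval f : laurent K n) !=set0).
case/eqP: f0; apply: fbval_inj; apply/funext => a /=.
by apply/eqP/negP => fa; case: none; exists a; apply/negP.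
Qed.

Lemma fb_domain : GRing.integral_domain_axiom fbseries.
Proof.
move=> f g fg0; apply/norP => -[/fbseries_neq0 f0 /fbseries_neq0 g0].
have [a] := lmul_domain (fbvalP f) (fbvalP g) f0 g0.
have -> : lmul (fbval f) (fbval g) = fbval (f * g) by [].
by rewrite fg0 /supp /= eqxx.
Qed.

Definition fb_unit : {pred fbseries} := fun f => `[< exists g, g * f = 1 >].
Definition fb_inv (f : fbseries) : fbseries := xget f [set g | g * f = 1].

Lemma fb_mulVf : {in fb_unit, left_inverse 1 fb_inv *%R}.
Proof. by move=> f /asboolP[g gf]; rewrite /fb_inv; case: xgetP => // /(_ g). Qed.

Lemma fb_unitP (f g : fbseries) : g * f = 1 -> fb_unit f.
Proof. by move=> gf; apply/asboolP; exists g. Qed.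

Lemma fb_inv_out : {in [predC fb_unit], fb_inv =1 id}.
Proof.
move=> f; rewrite inE => /asboolP nf; rewrite /fb_inv; case: xgetP => // g _ gf.
by case: nf; exists g.
Qed.

HB.instance Definition _ :=
  GRing.ComNzRing_hasMulInverse.Build fbseries fb_mulVf fb_unitP fb_inv_out.
HB.instance Definition _ :=
  GRing.ComUnitRing_isIntegral.Build fbseries fb_domain.

End SeriesRing.

(** * The recurrence satisfied by an algebraic series *)

Lemma finite_int_box n (N : nat) :
  finite_set [set a : 'rV[int]_n | forall i, (`|a 0%R i| <= N)%N].
Proof.
pose f (u : {ffun 'I_n -> 'I_(N.*2.+1)}) : 'rV[int]_n := \row_i ((u i)%:Z - N%:Z).
apply: (@sub_finite_set _ _ (f @` setT)); last first.
  by apply: finite_image; exact: finite_finset.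
move=> a /= aN; exists [ffun i => inord `|(a 0 i + N%:Z)%R|%N] => //.
apply/rowP => i; rewrite mxE ffunE inordK; have := aN i; lia.
Qed.

Definition positive {R : realType} {n} (omega : 'rV[R]_n) : Prop :=
  forall i, 0 < omega 0 i.

Definition nonneg {n} (a : 'rV[int]_n) : Prop := forall i, 0 <= a 0 i.

Section Orthant.
Context {R : realType} {n : nat}.
Implicit Types (omega : 'rV[R]_n) (a : 'rV[int]_n).

Lemma orthant_int_vec a : orthant R n (int_vec a) <-> nonneg a.
Proof. by split=> a0 i; have := a0 i; rewrite mxE ler0z. Qed.

(** A bound on the weight bounds every coordinate, which leaves a finite box of integer points. *)
Lemma finite_below_coercive (A : set 'rV[int]_n) omega (e c : R) : 0 < e ->
  (forall a, A a -> forall i, e * `|(a 0 i)%:~R| <= wt omega a + c) ->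
  finite_below omega A.
Proof.
move=> e0 Ae t; apply: (@sub_finite_set _ _ _ _
  (@finite_int_box n (Num.truncn ((`|t + c| + 1) / e)).+1)) => a [Aa wat] i /=.
rewrite -(ler_nat R) natr_absz intr_norm; apply: le_trans (ltW (truncnS_gt _)).
rewrite ler_pdivlMr // mulrC (le_trans (Ae _ Aa i)) //.
by have := ler_norm (t + c); lra.
Qed.

Lemma wt_nonneg omega a : (forall i, 0 <= omega 0 i) -> nonneg a -> 0 <= wt omega a.
Proof.
by move=> o0 a0; rewrite wtE sumr_ge0 // => i _; rewrite mulr_ge0 ?ler0z.
Qed.

Lemma wt_ge_coord omega a i : positive omega -> nonneg a ->
  omega 0 i * (a 0 i)%:~R <= wt omega a.
Proof.
move=> o0 a0; rewrite wtE (bigD1 i) //= lerDl sumr_ge0 // => j _.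
by rewrite mulr_ge0 ?ler0z // ltW.
Qed.

Lemma positive_lower omega : positive omega ->
  exists2 e, 0 < e & forall i, e <= omega 0 i.
Proof.
move=> o0; case: n omega o0 => [omega _|m omega o0].
  by exists 1 => // -[].
have [||i _ imin] := @finite_argmin _ _ R [set: 'I_m.+1] (fun i => omega 0 i).
- exact: finite_finset.
- by exists ord0.
by exists (omega 0 i) => // j; exact: imin.
Qed.

Lemma finite_below_nonneg omega : positive omega -> finite_below omega nonneg.
Proof.
move=> o0; have [e e0 eP] := positive_lower o0.
apply: (@finite_below_coercive _ _ e 0) => // a a0 i; rewrite addr0.
apply: le_trans (wt_ge_coord i o0 a0).
by rewrite ger0_norm ?ler0z // ler_wpM2r ?ler0z.
Qed.

End Orthant.

Definition int_dot {n} (lam a : 'rV[int]_n) : int := \sum_i lam 0 i * a 0 i.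

Lemma int_dotD n (lam a b : 'rV[int]_n) :
  int_dot lam (a + b) = int_dot lam a + int_dot lam b.
Proof.
by rewrite /int_dot -big_split; apply: eq_bigr => i _; rewrite mxE mulrDr.
Qed.

Section SeriesDerivation.
Context {R : realType} (K : fieldType) {n : nat} (omega : 'rV[R]_n).
Context (lam : 'rV[int]_n).
Local Notation series := (fbseries K omega).

(** The operator sum of [lam_i x_i d/dx_i]: each monomial [x^a] is an eigenvector, with eigenvalue
    [int_dot lam a]. *)
Definition lder (f : laurent K n) : laurent K n :=
  fun a => (int_dot lam a)%:~R * f a.

Lemma finite_below_lder (f : laurent K n) :
  finite_below omega (supp f) -> finite_below omega (supp (lder f)).
Proof.
apply: finite_below_sub => a; rewrite /supp /= /lder.
by apply: contra_neq => ->; rewrite mulr0.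
Qed.

Definition fb_der (f : series) : series := to_fb (finite_below_lder (fbvalP f)).

Lemma fb_der_zmod : zmod_morphism fb_der.
Proof.
move=> f g; apply: fbval_inj; apply/funext => a /=.
by rewrite /lder -[(_ - _) a]/(fbval f a - fbval g a) mulrBr.
Qed.

HB.instance Definition _ := GRing.isZmodMorphism.Build _ _ fb_der fb_der_zmod.

Lemma fb_derM (f g : series) : fb_der (f * g) = fb_der f * g + f * fb_der g.
Proof.
apply: fbval_inj; apply/funext => a /=.
rewrite -[RHS]/(lmul (lder (fbval f)) (fbval g) a
              + lmul (fbval f) (lder (fbval g)) a) /lder.
have /finite_seqP[s0 Es0] := finite_below_lmul_fun a (fbvalP f) (fbvalP g).
pose s := undup s0.
have sP b : fbval f b != 0 -> fbval g (a - b) != 0 -> b \in s.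
  by move=> fb gb; rewrite mem_undup; have : [set` s0] b by rewrite -Es0.
have us : uniq s by exact: undup_uniq.
rewrite !(lmul_seq us) //.
- rewrite -big_split mulr_sumr; apply: eq_bigr => b _ /=.
  have -> : int_dot lam a = int_dot lam (a - b) + int_dot lam b.
    by rewrite -int_dotD subrK.
  by rewrite intrD; ring.
- by move=> b fb; rewrite mulf_eq0 negb_or => /andP[_]; exact: sP.
- by move=> b; rewrite mulf_eq0 negb_or => /andP[_]; exact: sP.
Qed.

Definition power_series : {pred series} :=
  fun f => `[< cone_series (orthant R n) (fbval f : laurent K n) >].

Lemma power_seriesP (f : series) :
  reflect (forall a, fbval f a != 0 -> nonneg a) (f \in power_series).
Proof.
apply: (iffP (asboolP _)) => fP a fa; apply/(@orthant_int_vec R); exact: fP.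
Qed.

Lemma power_series_subring : subring_closed power_series.
Proof.
split.
- apply/power_seriesP => a; rewrite /= /lone.
  by case: (a =P 0) => [-> _ i|_] /=; rewrite ?mxE // eqxx.
- move=> f g /power_seriesP fP /power_seriesP gP; apply/power_seriesP => a.
  have [f0|/fP //] := eqVneq (fbval f a) 0.
  have [g0|/gP //] := eqVneq (fbval g a) 0.
  by rewrite -[fbval (f - g) a]/(fbval f a - fbval g a) f0 g0 subr0 eqxx.
move=> f g /power_seriesP fP /power_seriesP gP; apply/power_seriesP => a.
move=> /lmul_neq0[b [/fP b0 /gP ab0]] i.
by have := addr_ge0 (b0 i) (ab0 i); rewrite !mxE addrCA subrr addr0.
Qed.

HB.instance Definition _ :=
  GRing.isSubringClosed.Build _ power_series power_series_subring.

Lemma power_series_der f : f \in power_series -> fb_der f \in power_series.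
Proof.
move=> /power_seriesP fP; apply/power_seriesP => a /=; rewrite /lder.
by rewrite mulf_eq0 negb_or => /andP[_]; exact: fP.
Qed.

Lemma fbval_sum I (r : seq I) (P : pred I) (F : I -> series) a :
  fbval (\sum_(i <- r | P i) F i) a = \sum_(i <- r | P i) fbval (F i) a.
Proof. by elim/big_rec2: _ => // i y x _ <-. Qed.

Lemma fbval_natr m a : fbval (m%:R : series) a = (a == 0)%:R *+ m.
Proof.
elim: m => [|m IHm]; first by rewrite mulr0n.
by rewrite !mulrS -IHm.
Qed.

Lemma fbval_exp (f : series) j : fbval (f ^+ j) = lexp (fbval f) j.
Proof. by elim: j => // j IHj; rewrite exprS /= IHj. Qed.

Lemma fbval_iter_der (f : series) j a :
  fbval (iter j fb_der f) a = (int_dot lam a)%:~R ^+ j * fbval f a.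
Proof.
elim: j a => [|j IHj] a; first by rewrite mul1r.
by rewrite iterS /= /lder IHj exprS mulrA.
Qed.

(** In the differential equation the coefficient at [a + d] is the sum of the values of [chi d'] at
    [int_dot lam a'] times [xi a'], over [a' + d' = a + d]. A term that stands alone must vanish. *)
Lemma algebraic_recurrence (xi : laurent K n) :
  [pchar K] =i pred0 -> positive omega -> finite_below omega (supp xi) ->
  algebraic_over_power_series R xi ->
  exists chi : 'rV[int]_n -> {poly K},
    [/\ exists d, chi d != 0,
        forall d, chi d != 0 -> nonneg d &
        forall a d, (forall a' d', xi a' != 0 -> chi d' != 0 ->
                       a' + d' = a + d -> d' = d) ->
                    xi a != 0 -> root (chi d) (int_dot lam a)%:~R].
Proof.
move=> charK o0 fxi [d [P [PO [j0 [a0 Pa0]] Pxi]]].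
have fP j : finite_below omega (supp (P j)).
  apply: finite_below_sub (finite_below_nonneg o0) => a Pa.
  by apply/(@orthant_int_vec R); exact: PO Pa.
pose x := to_fb fxi; pose Q j := to_fb (fP j).
pose p := \poly_(j < d) (if insub j is Some j' then Q j' else 0).
have Ep (j : 'I_d) : p`_j = Q j by rewrite coef_poly ltn_ord valK.
have p0 : p != 0.
  apply/eqP => /polyP/(_ j0); rewrite Ep coef0 => /(congr1 (fun f => fbval f a0)) /eqP.
  by rewrite /= (negPf Pa0).
have px : root p x.
  apply/eqP; apply: fbval_inj; apply/funext => a; rewrite -[RHS](Pxi a).
  rewrite horner_poly fbval_sum /leval; apply: eq_bigr => j _.
  by rewrite valK /= fbval_exp.
have Sp : p \is a polyOver power_series.
  apply/polyOverP => j; rewrite coef_poly; case: ifP => _; last exact: rpred0.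
  case: insubP => [j' _ _|_]; last exact: rpred0.
  by apply/asboolP; exact: PO.
have char0 m : m.+1%:R != 0 :> series.
  apply/eqP => /(congr1 (fun f => fbval f 0)) /eqP.
  by rewrite fbval_natr eqxx (pcharf0P K).1.
have [m [c [Sc [k0 ck0] Ec]]] :=
  algebraic_linear_ode fb_derM power_series_der char0 Sp p0 px.
(* [chi b] gathers the coefficients at [x^b] of the operator coefficients, as a polynomial in the
   eigenvalue. *)
exists (fun b => \poly_(k < m) (if insub k is Some k' then fbval (c k') b else 0)).
have chi0 b : \poly_(k < m) (if insub k is Some k' then fbval (c k') b else 0) != 0 ->
    exists k, fbval (c k) b != 0.
  move=> c0; have [//|none] := pselect (exists k, fbval (c k) b != 0).
  case/eqP: c0; apply/polyP => k; rewrite coef_poly coef0; case: ifP => // _.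
  case: insubP => // k' _ _; apply/eqP/negP => ck'.
  by case: none; exists k'; apply/negP.
split.
- have [b cb] := fbseries_neq0 ck0; exists b; apply/eqP => /polyP/(_ k0).
  by rewrite coef_poly ltn_ord valK coef0 => /eqP; apply/negP.
- by move=> b /chi0[k ck]; have /power_seriesP := Sc k; apply.
move=> a b ab xa.
have := congr1 (fun f => fbval f (a + b)) Ec; rewrite /= fbval_sum => Eab.
rewrite /root horner_poly; apply/eqP; apply: (mulIf xa); rewrite mul0r -[RHS]Eab.
rewrite mulr_suml; apply: eq_bigr => k _; rewrite valK.
rewrite -[RHS]/(lmul (fbval (c k)) (fbval (iter k fb_der x)) (a + b)).
rewrite (@lmul_single _ _ _ _ _ b) ?fbval_iter_der ?addrK ?mulrA // => b' cb'.
rewrite fbval_iter_der mulf_eq0 negb_or => /andP[_ xb'].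
apply: ab xb' _ _; last by rewrite subrK.
apply/eqP => /polyP/(_ k); rewrite coef_poly ltn_ord valK coef0 => /eqP.
exact/negP.
Qed.

End SeriesDerivation.

(** * Minimal exponents and extremal pairs *)

(** [g N] is an index at which [u] is minimal from [N] on; iterating [g] past the last index found
    gives the subsequence. *)
Lemma nat_seq_nondecreasing_subseq (u : nat -> nat) :
  exists phi : nat -> nat, {homo phi : i j / (i < j)%N} /\
    {homo u \o phi : i j / (i <= j)%N}.
Proof.
have /choice[g gP] (N : nat) : exists j, (N <= j)%N /\
    forall k, (N <= k)%N -> (u j <= u k)%N.
  pose P m := `[< exists2 j, (N <= j)%N & u j = m >].
  have exP : exists m, P m by exists (u N); apply/asboolP; exists N.
  case: (ex_minnP exP) => m /asboolP[j Nj <-] jmin; exists j; split=> // k Nk.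
  by apply: jmin; apply/asboolP; exists k.
pose phi k := iter k (fun j => g j.+1) (g 0%N).
have phiS k : (phi k < phi k.+1)%N by have [] := gP (phi k).+1.
have umin k j : (phi k <= j)%N -> (u (phi k) <= u j)%N.
  case: k => [|k] kj; first by have [_] := gP 0%N; apply.
  have [gk] := gP (phi k).+1; apply; exact: leq_trans gk kj.
have phi_lt : {homo phi : i j / (i < j)%N}.
  by apply: homo_ltn => // ? ? ?; exact: ltn_trans.
exists phi; split=> // i j; rewrite leq_eqVlt => /orP[/eqP ->//|ij].
by apply: umin; exact: ltnW (phi_lt _ _ ij).
Qed.

Section Dickson.
Context {n : nat}.
Implicit Types (X : set 'rV[int]_n) (d : 'rV[int]_n).

Definition minimal_in X d : Prop :=
  X d /\ forall d', X d' -> nonneg (d - d') -> d' = d.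

(** Dickson's lemma: pass to a subsequence once per coordinate, until every coordinate is
    nondecreasing. *)
Lemma nonneg_seq_subseq (u : nat -> 'rV[int]_n) : (forall k, nonneg (u k)) ->
  exists i j, (i < j)%N /\ nonneg (u j - u i).
Proof.
move=> u0.
have [phi [phi_lt uphi]] : exists phi : nat -> nat, {homo phi : i j / (i < j)%N} /\
    forall l, l \in enum 'I_n ->
      {homo (fun k => `|u (phi k) 0%R l|%N) : i j / (i <= j)%N}.
  elim: (enum 'I_n) => [|l s [phi [phi_lt uphi]]].
    by exists id; split=> // l; rewrite in_nil.
  have [psi [psi_lt upsi]] :=
    nat_seq_nondecreasing_subseq (fun k => `|u (phi k) 0%R l|%N).
  exists (phi \o psi); split=> [i j ij|l']; first by apply: phi_lt; apply: psi_lt.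
  have psi_le : {homo psi : i j / (i <= j)%N}.
    by move=> i j; rewrite leq_eqVlt => /orP[/eqP ->|/psi_lt/ltnW].
  rewrite inE => /orP[/eqP ->|l's] i j ij; first exact: upsi.
  by apply: uphi => //; exact: psi_le.
exists (phi 0%N), (phi 1%N); split; first exact: phi_lt.
move=> l; have := uphi l (mem_enum _ l) 0%N 1%N isT.
have := u0 (phi 0%N) l; have := u0 (phi 1%N) l; rewrite !mxE.
by move: (u _ _ _) (u _ _ _) => x y; lia.
Qed.

(** An injective sequence of minimal elements would contain two comparable ones, which minimality
    identifies. *)
Lemma finite_minimal_in X : X `<=` nonneg -> finite_set (minimal_in X).
Proof.
move=> X0; have [//|/infiniteP Minf] := pselect (finite_set (minimal_in X)).
have /unsquash f :
    $|{injfun [set: set_type [set: nat]] >-> [set: set_type (minimal_in X)]}|.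
  exact/card_leP.
pose u k : 'rV[int]_n := \val (f (to_setT k)).
have uM k : minimal_in X (u k) by exact: set_valP.
have [k|i [j [ij uij]]] := @nonneg_seq_subseq u.
  by apply: X0; have [] := uM k.
have /val_inj/(@inj _ _ _ f) : u i = u j.
  by have [_] := uM j; apply => //; have [] := uM i.
rewrite !in_setT => /(_ isT isT) /(congr1 \val) /= Eij.
by rewrite Eij ltnn in ij.
Qed.

End Dickson.

Section PositiveWeights.
Context {R : realType} {n : nat}.
Implicit Types (omega rho : 'rV[R]_n) (A X : set 'rV[int]_n).

Lemma positive_wt_eq0 omega (a : 'rV[int]_n) :
  positive omega -> nonneg a -> wt omega a <= 0 -> a = 0.
Proof.
move=> o0 a0 wa; apply/rowP => i; rewrite mxE.
have := le_trans (wt_ge_coord i o0 a0) wa; rewrite pmulr_rle0 // lerz0.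
by move=> ai; apply/eqP; rewrite eq_le ai a0.
Qed.

Lemma minimal_in_below X d : X `<=` nonneg -> X d ->
  exists2 m, minimal_in X m & nonneg (d - m).
Proof.
(* The weight [one] is the total degree; minimizing it among the elements below [d] gives a minimal
   element. *)
move=> X0 Xd; pose one : 'rV[R]_n := const_mx 1.
have one0 : positive one by move=> i; rewrite mxE.
have fX := finite_below_sub X0 (finite_below_nonneg one0).
have [||m [Xm dm] mmin] :=
  @finite_below_argmin _ _ one [set m | X m /\ nonneg (d - m)].
- by apply: finite_below_sub fX => m [].
- by exists d; split=> // i; rewrite subrr mxE.
exists m => //; split=> // d' Xd' md'; apply/esym/subr0_eq.
apply: (positive_wt_eq0 one0 md'); rewrite wtB subr_le0.
apply: mmin; split=> //= i.
by have := addr_ge0 (dm i) (md' i); rewrite !mxE addrA subrK.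
Qed.

(** A positive weight is strictly increasing for the componentwise order. *)
Lemma wt_argmin_minimal omega X d : positive omega -> X d ->
  (forall d', X d' -> wt omega d <= wt omega d') -> minimal_in X d.
Proof.
move=> o0 Xd dmin; split=> // d' Xd' dd'; apply/esym/subr0_eq.
by apply: (positive_wt_eq0 o0 dd'); rewrite wtB subr_le0 dmin.
Qed.

(** Take for [e] the minimum of [p / (|q| + 1)]: then [p + e * q] is at least
    [e * (|q| + 1) - e * |q| = e]. *)
Lemma finite_perturbation {T : choiceType} (A : set T) (p q : T -> R) :
  finite_set A -> (forall x, A x -> 0 < p x) ->
  exists2 e, 0 < e & forall x, A x -> 0 < p x + e * q x.
Proof.
move=> finA p0; have [[x0 Ax0]|none] := pselect (A !=set0); last first.
  by exists 1 => // x Ax; case: none; exists x.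
have [|x Ax xmin] := finite_argmin (fun x => p x / (`|q x| + 1)) finA.
  by exists x0.
have q1 y : 0 < `|q y| + 1 by rewrite ltr_wpDl.
exists (p x / (`|q x| + 1)); first by rewrite divr_gt0 // p0.
move=> y Ay; set e := p x / _.
have e0 : 0 < e by rewrite divr_gt0 // p0.
have := xmin y Ay; rewrite ler_pdivlMr // => eqy.
have : - (e * `|q y|) <= e * q y.
  by rewrite -mulrN ler_wpM2l ?(ltW e0) // lerNl -normrN ler_norm.
rewrite -/e in eqy; lra.
Qed.

(** As [s] is positive, the lower bound on [rho] turns a bound on the mixed weight into one on
    [omega]. *)
Lemma finite_below_mix omega rho A s r c : 0 < s -> 0 <= r ->
  finite_below omega A -> (forall a, A a -> c <= wt rho a) ->
  finite_below (s *: omega + r *: rho) A.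
Proof.
move=> s0 r0 finA rhoA t; apply: sub_finite_set (finA ((t - r * c) / s)).
move=> a [Aa]; rewrite wtDl !wtZl => at_; split=> //=.
rewrite ler_pdivlMr // mulrC.
by have := ler_wpM2l r0 (rhoA _ Aa); lra.
Qed.

End PositiveWeights.

Section ExtremalPairs.
Context {R : realType} {n : nat} (S X F : set 'rV[int]_n).
Implicit Types (omega rho theta : 'rV[R]_n).
Hypothesis X_nonneg : X `<=` nonneg.
Hypothesis X_neq0 : X !=set0.
Hypothesis finF : finite_set F.
(** The recurrence in combinatorial form: [S] stands for the support, [X] for the exponents with
    [chi d != 0], [F] for the exceptional exponents. *)
Hypothesis no_single : forall a d, S a -> ~ F a -> minimal_in X d ->
  exists a' d', [/\ S a', X d', a' + d' = a + d & d' <> d].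

(* Among the elements of S lying rho-below F, one minimizing omega and then
   rho cannot pair with a minimizer d0 of X without violating no_single. *)
Lemma wt_min_exceptional omega rho d0 : positive omega ->
  finite_below omega S -> X d0 ->
  (forall d, X d -> wt omega d0 <= wt omega d) ->
  (forall d, X d -> wt rho d0 <= wt rho d) ->
  forall a, S a -> exists2 a', F a' & wt rho a' <= wt rho a.
Proof.
move=> o0 finS Xd0 d0o d0r a1 Sa1.
have [//|nF] := pselect (exists2 a', F a' & wt rho a' <= wt rho a1).
pose bad := [set a | S a /\ forall a', F a' -> wt rho a < wt rho a'].
have badS : bad `<=` S by move=> a [].
have finB := finite_below_sub badS finS.
have [|a2 Ba2 a2min] := finite_below_argmin finB.
  exists a1; split=> // a' Fa'; rewrite ltNge; apply/negP => ?.
  by apply: nF; exists a'.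
have [||a3 [Ba3 oa3] a3min] :=
    @finite_argmin _ _ R [set a | bad a /\ wt omega a <= wt omega a2] (wt rho).
- exact: finB.
- by exists a2.
pose E := [set a | [/\ bad a, wt omega a <= wt omega a2 & wt rho a <= wt rho a3]].
pose Delta := [set d | [/\ X d, wt omega d <= wt omega d0 & wt rho d <= wt rho d0]].
have [||||a [d [[Ba oa ra] [Xd od rd] uniq_ad]]] := @unique_sum n E Delta.
- by apply: sub_finite_set (finB (wt omega a2)) => a [].
- apply: sub_finite_set (finite_below_nonneg o0 (wt omega d0)) => d [Xd od _].
  by split=> //; exact: X_nonneg.
- by exists a3.
- by exists d0.
have [Sa Fa] := Ba.
have [||a' [d' [Sa' Xd' ad' d'd]]] := no_single Sa _ (d := d).
- by move=> /Fa; rewrite ltxx.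
- by apply: (wt_argmin_minimal o0) => // d' Xd'; apply: le_trans od _; exact: d0o.
case: d'd.
have Eo : wt omega a' + wt omega d' = wt omega a + wt omega d by rewrite -!wtD ad'.
have Er : wt rho a' + wt rho d' = wt rho a + wt rho d by rewrite -!wtD ad'.
have d'o := d0o _ Xd'; have d'r := d0r _ Xd'.
(* Since [d] also minimizes [rho] on [X], passing from [a] to [a'] cannot raise [rho]; hence [a']
   stays in [bad]. *)
have ra'a : wt rho a' <= wt rho a by lra.
have Ba' : bad a' by split=> // b /Fa; exact: le_lt_trans.
have oa'2 : wt omega a' <= wt omega a2 by lra.
have := a2min _ Ba'; have := a3min _ (conj Ba' oa'2) => ra'3 oa2'.
have [||_ -> //] := uniq_ad a' d' _ _ ad'; rewrite /E /Delta /=; split=> //; lra.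
Qed.

Lemma exists_wt_argmin omega : positive omega ->
  exists2 d, X d & forall d', X d' -> wt omega d <= wt omega d'.
Proof.
move=> o0; apply: finite_below_argmin X_neq0.
exact: finite_below_sub X_nonneg (finite_below_nonneg o0).
Qed.

(** One translation serves every positive weight, so the lower bounds it provides on [S] survive
    limits of weights. *)
Definition shift_nonneg (b : 'rV[int]_n) := forall a, F a -> nonneg (a + b).

Lemma shift_nonneg_exists : exists b, shift_nonneg b.
Proof.
have /choice[u uP] (i : 'I_n) : exists c : int, forall a, F a -> 0 <= a 0 i + c.
  have [[a Fa]|none] := pselect (F !=set0); last first.
    by exists 0 => a Fa; case: none; exists a.
  have [|a0 _ a0min] := finite_argmin (fun a : 'rV[int]_n => a 0 i) finF.
    by exists a.
  by exists (- a0 0 i) => b /a0min; rewrite subr_ge0.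
by exists (\row_i u i) => a Fa i; rewrite !mxE uP.
Qed.

Variables (b : 'rV[int]_n).
Hypothesis bF : shift_nonneg b.

Lemma wt_bound omega rho d0 : positive omega -> positive rho ->
  finite_below omega S -> X d0 ->
  (forall d, X d -> wt omega d0 <= wt omega d) ->
  (forall d, X d -> wt rho d0 <= wt rho d) ->
  forall a, S a -> 0 <= wt rho (a + b).
Proof.
move=> o0 r0 finS Xd0 d0o d0r a Sa.
have [a' Fa' a'a] := wt_min_exceptional o0 finS Xd0 d0o d0r Sa.
have : 0 <= wt rho (a' + b) by apply: wt_nonneg (bF Fa') => i; exact: ltW.
by rewrite !wtD; lra.
Qed.

Lemma finite_below_wt_bound omega : positive omega -> finite_below omega S ->
  forall a, S a -> 0 <= wt omega (a + b).
Proof.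
move=> o0 finS; have [d Xd dmin] := exists_wt_argmin o0.
exact: (wt_bound o0 o0 finS Xd dmin dmin).
Qed.

(** A point [d0] of [X] minimizing [omega], then [theta], still minimizes a slightly tilted weight
    [rho]. Then [wt_bound] bounds [rho] below on [S], and the weights in between are mixtures of
    [omega] and [rho]. *)
Lemma finite_below_open omega theta : positive omega -> finite_below omega S ->
  exists2 e, 0 < e &
    forall e', 0 <= e' <= e -> finite_below (omega + e' *: theta) S.
Proof.
move=> o0 finS; have [d1 Xd1 d1min] := exists_wt_argmin o0.
pose M := [set d | X d /\ wt omega d <= wt omega d1].
have [||d0 [Xd0 od0] d0min] := @finite_argmin _ _ R M (wt theta).
- apply: sub_finite_set (finite_below_nonneg o0 (wt omega d1)) => d [Xd od].
  by split=> //; exact: X_nonneg.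
- by exists d1.
have [||e1 e1_gt0 e1P] := @finite_perturbation R _
  [set d | minimal_in X d /\ wt omega d1 < wt omega d]
  (fun d => wt omega d - wt omega d1) (fun d => wt theta d - wt theta d0).
- by apply: sub_finite_set (finite_minimal_in X_nonneg) => d [].
- by move=> d [_]; rewrite subr_gt0.
have [||e2 e2_gt0 e2P] := @finite_perturbation R _ [set: 'I_n]
  (fun i => omega 0 i) (fun i => theta 0 i).
- exact: finite_finset.
- by move=> i _; exact: o0.
pose e := Num.min e1 e2.
have e_gt0 : 0 < e by rewrite lt_min e1_gt0.
pose rho := omega + e *: theta.
have r0 : positive rho.
  move=> i; rewrite !mxE; have := e2P i I; have := o0 i.
  have : e <= e2 by rewrite ge_min lexx orbT.
  by move: (omega 0 i) (theta 0 i) => x y; nra.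
(* Only finitely many minimal elements compete: [theta] settles ties for [omega], the smallness of
   [e] settles the rest. *)
have rmin m : minimal_in X m -> wt rho d0 <= wt rho m.
  move=> Xm; rewrite !wtDl !wtZl; have := d1min _ (proj1 Xm).
  rewrite le_eqVlt => /orP[/eqP Em|lt_m].
    have : M m by split; [case: Xm | rewrite /= Em].
    by move=> /d0min; rewrite -(ler_pM2l e_gt0); lra.
  have := e1P _ (conj Xm lt_m) => /=.
  have : e <= e1 by rewrite ge_min lexx.
  move: lt_m od0 => /=; move: (wt omega _) (wt omega _) (wt omega _) => x y z.
  by move: (wt theta _) (wt theta _) => t u; nra.
have rmin' d : X d -> wt rho d0 <= wt rho d.
  move=> Xd; have [m Xm dm] := minimal_in_below (R := R) X_nonneg Xd.
  apply: le_trans (rmin _ Xm) _; rewrite -subr_ge0 -wtB.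
  by apply: wt_nonneg dm => i; exact: ltW.
have omin' d : X d -> wt omega d0 <= wt omega d.
  by move=> Xd; apply: le_trans od0 _; exact: d1min.
(* Stopping halfway leaves a positive share of [omega] in the mixture. *)
exists (e / 2) => [|e' /andP[e'0 e'e]]; first by rewrite divr_gt0.
have -> : omega + e' *: theta = (1 - e' / e) *: omega + (e' / e) *: rho.
  by apply/rowP => i; rewrite !mxE; field; rewrite gt_eqF.
apply: (@finite_below_mix _ _ _ _ _ _ _ (- wt rho b)) => //.
- by rewrite subr_gt0 ltr_pdivrMr // mul1r; lra.
- by rewrite divr_ge0 // ltW.
move=> a Sa; have := wt_bound o0 r0 finS Xd0 omin' rmin' Sa.
by rewrite wtD; lra.
Qed.

(** On the segment from [omega] to [omega1], take the supremum of the parameters with finite levels.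
    Openness excludes finiteness there, while the uniform lower bound passes to the limit. *)
Lemma boundary_weight omega omega1 : positive omega -> finite_below omega S ->
  positive omega1 -> ~ finite_below omega1 S ->
  exists omega0, [/\ positive omega0, ~ finite_below omega0 S &
    forall a, S a -> 0 <= wt omega0 (a + b)].
Proof.
move=> o0 finS o10 infS.
pose om (s : R) := omega + s *: (omega1 - omega).
have wt_om s a : wt (om s) a = wt omega a + s * (wt omega1 a - wt omega a).
  by rewrite /om wtDl wtZl wtDl -scaleN1r wtZl; ring.
have om_pos s : 0 <= s <= 1 -> positive (om s).
  move=> /andP[s0 s1] i; rewrite !mxE; have := o0 i; have := o10 i.
  by move: (omega 0 i) (omega1 0 i) => x y; nra.
pose T := [set s : R | 0 <= s <= 1 /\ finite_below (om s) S].
have T0 : T 0.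
  by split; rewrite ?lexx ?ler01 // /om scale0r addr0.
have supT : has_sup T by split; [exists 0 | exists 1 => s [/andP[]]].
pose s0 := sup T.
have s00 : 0 <= s0 by apply: ub_le_sup => //; case: supT.
have s01 : s0 <= 1 by apply: ge_sup; [exists 0 | move=> s [/andP[]]].
have below s : 0 <= s -> s < s0 -> finite_below (om s) S.
  move=> s_ge0 ss0; have [s' [/andP[s'0 s'1] fin'] ss'] := sup_gt (ex_intro _ _ T0) ss0.
  have s'_gt0 : 0 < s' by exact: le_lt_trans s_ge0 ss'.
  have -> : om s = (1 - s / s') *: omega + (s / s') *: om s'.
    by apply/rowP => i; rewrite !mxE; field; rewrite gt_eqF.
  apply: (@finite_below_mix _ _ _ _ _ _ _ (- wt (om s') b)) => //.
  - by rewrite subr_gt0 ltr_pdivrMr // mul1r.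
  - by rewrite divr_ge0.
  move=> a Sa; have := finite_below_wt_bound (om_pos _ _) fin' Sa.
  by rewrite s'0 s'1 wtD => /(_ isT); lra.
exists (om s0); split.
- by apply: om_pos; rewrite s00.
- move=> fin0; have os0 : positive (om s0) by apply: om_pos; rewrite s00.
  have : s0 < 1.
    rewrite lt_neqAle s01 andbT; apply/eqP => s0E; apply: infS.
    by move: fin0; rewrite /om s0E scale1r addrC subrK.
  have [e e0 fine] := finite_below_open (omega1 - omega) os0 fin0.
  move=> s0_lt1; pose e' := Num.min e (1 - s0).
  have e'0 : 0 < e' by rewrite lt_min e0 subr_gt0.
  have e'e : e' <= e by rewrite ge_min lexx.
  have e'1 : e' <= 1 - s0 by rewrite ge_min lexx orbT.
  have T' : T (s0 + e').
    split; first by rewrite addr_ge0 ?(ltW e'0) //=; lra.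
    have -> : om (s0 + e') = om s0 + e' *: (omega1 - omega).
      by rewrite /om scalerDl addrA.
    by apply: fine; rewrite e'e ltW.
  have : s0 + e' <= s0 by apply: ub_le_sup T' => //; case: supT.
  by lra.
move=> a Sa; rewrite leNgt; apply/negP; rewrite wt_om.
set p := wt omega (a + b); set q := _ - _ => pq.
have p0 : 0 <= p by exact: finite_below_wt_bound.
have q0 : q < 0 by rewrite ltNge; apply/negP => q0; have := mulr_ge0 s00 q0; lra.
(* The midpoint between [s0] and the zero [- p / q] of [p + s * q]: a parameter below [s0] at which
   the weight is still negative. *)
pose s := (s0 - p / q) / 2.
have sq : s * q = (s0 * q - p) / 2 by rewrite /s; field; rewrite lt_eqF.
have s_ge0 : 0 <= s.
  have : 0 <= p / - q by rewrite divr_ge0 // oppr_ge0 ltW.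
  by rewrite invrN mulrN /s; lra.
have s_lt : s < s0.
  have : s0 * q < s * q by rewrite sq; lra.
  by rewrite ltr_nM2r.
have os : positive (om s) by apply: om_pos; rewrite s_ge0 /=; lra.
have := finite_below_wt_bound os (below _ s_ge0 s_lt) Sa.
by rewrite wt_om -/p -/q sq; lra.
Qed.

End ExtremalPairs.

(** * Infinite windows of the support and bounded gaps *)

Section Gaps.
Context {R : realType} {n : nat} (S X F : set 'rV[int]_n).
Implicit Types (omega : 'rV[R]_n).
Hypothesis X_nonneg : X `<=` nonneg.
Hypothesis X_neq0 : X !=set0.
Hypothesis finF : finite_set F.
Hypothesis no_single : forall a d, S a -> ~ F a -> minimal_in X d ->
  exists a' d', [/\ S a', X d', a' + d' = a + d & d' <> d].

(** If all positive weights had finite levels, the uniform bound would hold for all of them; letting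
    them tend to the coordinate weights would put [S] in a translate of the orthant. *)
Lemma boundary_weight_exists omega :
  positive omega -> finite_below omega S ->
  ~ (exists b, forall a, S a -> nonneg (a + b)) ->
  exists (omega0 : 'rV[R]_n) b, [/\ positive omega0, ~ finite_below omega0 S &
    forall a, S a -> 0 <= wt omega0 (a + b)].
Proof.
move=> o0 finS unbounded; have [b bF] := shift_nonneg_exists finF.
have [[omega1 [pos1 infS]]|all_fin] :=
    pselect (exists omega1 : 'rV[R]_n, positive omega1 /\ ~ finite_below omega1 S).
  have [omega0 omega0P] :=
    boundary_weight X_nonneg X_neq0 no_single bF o0 finS pos1 infS.
  by exists omega0, b.
case: unbounded; exists b => a Sa i.
pose rho : 'rV[R]_n := delta_mx 0 i.
rewrite -(@ler0z R) leNgt; apply/negP => abi.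
have wt_rho : wt rho (a + b) = ((a + b) 0 i)%:~R.
  rewrite wtE (bigD1 i) //= big1 ?addr0 => [|j ji].
    by rewrite mxE !eqxx mul1r.
  by rewrite mxE (negPf ji) andbF mul0r.
pose w := wt omega (a + b).
(* With this [e], the [omega] term offsets at most half of the negative coordinate. *)
pose e := - wt rho (a + b) / (2 * (`|w| + 1)).
have w1 : 0 < `|w| + 1 by rewrite ltr_wpDl.
have e0 : 0 < e by rewrite divr_gt0 ?mulr_gt0 // oppr_gt0 wt_rho.
have oe0 : positive (rho + e *: omega).
  by move=> j; rewrite !mxE ltr_wpDl ?ler0n // mulr_gt0 ?o0.
have fine : finite_below (rho + e *: omega) S.
  by have [//|nf] := pselect (finite_below (rho + e *: omega) S);
     case: all_fin; exists (rho + e *: omega).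
have := finite_below_wt_bound X_nonneg X_neq0 no_single bF oe0 fine Sa.
rewrite wtDl wtZl -/w.
have : e * w <= e * (`|w| + 1) by rewrite ler_pM2l // ler_wpDr // ler_norm.
have -> : e * (`|w| + 1) = - wt rho (a + b) / 2 by rewrite /e; field; rewrite gt_eqF.
by rewrite wt_rho; lra.
Qed.

(** [X] has finitely many points of weight at most one above the minimum, so the minimal weight is
    isolated. The gap [delta] will be the width of the window. *)
Lemma wt_gap omega : positive omega -> exists d0 (delta : R),
  [/\ X d0, 0 < delta, forall d, X d -> wt omega d0 <= wt omega d &
    forall d, X d -> wt omega d < wt omega d0 + delta -> wt omega d <= wt omega d0].
Proof.
move=> o0; have [d0 Xd0 d0min] := exists_wt_argmin X_nonneg X_neq0 o0.
pose A := [set d | (X d /\ wt omega d <= wt omega d0 + 1) /\ wt omega d0 < wt omega d].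
have finA : finite_set A.
  apply: sub_finite_set (finite_below_nonneg o0 (wt omega d0 + 1)) => d [[Xd ?] _].
  by split=> //; exact: X_nonneg.
have [[d1 Ad1]|none] := pselect (A !=set0); last first.
  exists d0, 1; split=> // d Xd dd0; rewrite leNgt; apply/negP => d0d.
  by case: none; exists d; split=> //; split=> //; exact: ltW.
have [|d2 [[Xd2 d2le] d2gt] d2min] := finite_argmin (wt omega) finA.
  by exists d1.
exists d0, (wt omega d2 - wt omega d0); split=> //; first by rewrite subr_gt0.
move=> d Xd; rewrite addrC subrK => dd2; rewrite leNgt; apply/negP => d0d.
have /d2min : A d by split=> //; split=> //; apply: le_trans (ltW dd2) d2le.
by rewrite leNgt dd2.
Qed.

(** Slice the weights into intervals of length [delta] from the lower bound [c] upwards; the first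
    slice with infinitely many points is the window. *)
Lemma first_infinite_window omega0 b (delta : R) : 0 < delta ->
  ~ finite_below omega0 S -> (forall a, S a -> 0 <= wt omega0 (a + b)) ->
  exists t, finite_set [set a | S a /\ wt omega0 a < t] /\
    ~ finite_set [set a | S a /\ t <= wt omega0 a < t + delta].
Proof.
move=> d_gt0 /existsNP[t0 inf_t0] Sb; pose c := - wt omega0 b.
pose P j := `[< ~ finite_set [set a | S a /\ wt omega0 a < c + j%:R * delta] >].
have exP : exists j, P j.
  exists (Num.truncn (`|t0 - c| / delta)).+1; apply/asboolP; apply: contra_not inf_t0.
  apply: sub_finite_set => a [Sa at0]; split=> //=; apply: le_lt_trans at0 _.
  have := truncnS_gt (`|t0 - c| / delta); rewrite ltr_pdivrMr //.
  by have := ler_norm (t0 - c); lra.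
case: (ex_minnP exP) => j /asboolP infj jmin.
case: j infj jmin => [|j] infj jmin.
  case: infj; apply: (@sub_finite_set _ _ set0) => // a [Sa].
  by have := Sb _ Sa; rewrite wtD mul0r addr0 /c /=; lra.
have finj : finite_set [set a | S a /\ wt omega0 a < c + j%:R * delta].
  have [//|nf] := pselect (finite_set [set a | S a /\ wt omega0 a < c + j%:R * delta]).
  by have /jmin : P j by [apply/asboolP]; rewrite ltnn.
exists (c + j%:R * delta); split=> // finw; apply: infj.
have /sub_finite_set : [set a | S a /\ wt omega0 a < c + j.+1%:R * delta] `<=`
    [set a | S a /\ wt omega0 a < c + j%:R * delta] `|`
    [set a | S a /\ c + j%:R * delta <= wt omega0 a < c + j%:R * delta + delta].
  move=> a [Sa /=]; rewrite -natr1 mulrDl mul1r addrA => lt_a.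
  by have [ge_a|] := leP (c + j%:R * delta) (wt omega0 a); [right | left].
by apply; rewrite finite_setU.
Qed.

(** If a gap longer than [W] followed [tau], the [omega]-first window points after it and the
    [omega]-lowest points of the face would form an extremal pair. Any competing pair again consists
    of a window point beyond [tau] and a face point. *)
Lemma bounded_gaps omega : positive omega -> finite_below omega S ->
  ~ (exists b, forall a, S a -> nonneg (a + b)) ->
  exists W T : R, 0 < W /\
    forall tau, T <= tau -> exists2 a, S a & tau < wt omega a <= tau + W.
Proof.
move=> o_pos finS unbounded.
have [omega0 [b [pos0 infS Sb]]] := boundary_weight_exists o_pos finS unbounded.
have [d0 [delta [Xd0 delta_gt0 d0min gap]]] := wt_gap pos0.
have [t [finF1 infW]] := first_infinite_window delta_gt0 infS Sb.
have Sc a : S a -> - wt omega0 b <= wt omega0 a.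
  by move=> /Sb; rewrite wtD; lra.
have finX (u : R) : finite_set [set d | X d /\ wt omega0 d <= u].
  exact: (finite_below_sub X_nonneg (finite_below_nonneg pos0)).
pose face := [set d | X d /\ wt omega0 d <= wt omega0 d0].
have [|d1 [Xd1 d1o0] d1min] := finite_argmin (wt omega) (finX (wt omega0 d0)).
  by exists d0.
have [v vP] := finite_lower_bound (fun d => - wt omega d) (finX (wt omega0 d0)).
have [u uP] := finite_lower_bound (fun a => - wt omega a) finF.
(* The possible sums [a' + d'] with [a'] below the window: finitely many, hence avoided once [tau]
   is large. *)
have finG := finite_image (fun p => p.1 + p.2)
  (finite_setX finF1 (finX (t + delta + wt omega0 d0 + wt omega0 b))).
have [g gP] := finite_lower_bound (fun a => - wt omega a) finG.
(* [- v] bounds [omega] above on the face and [d1] minimizes it there, so [W] is at least the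
   [omega]-width of the face. *)
pose W := Num.max 1 (- v - wt omega d1).
have W_gt0 : 0 < W by rewrite lt_max ltr01.
have Wv : - v - wt omega d1 <= W by rewrite le_max lexx orbT.
exists W, (Num.max (- u) (- g - wt omega d1)); split=> // tau.
rewrite ge_max => /andP[tau_u tau_g].
have [//|none] := pselect (exists2 a, S a & tau < wt omega a <= tau + W).
pose window := [set a | S a /\ t <= wt omega0 a < t + delta].
have wS : window `<=` S by move=> a [].
pose H := [set a | window a /\ tau < wt omega a].
have HS : H `<=` S by move=> a [/wS].
have finH := finite_below_sub HS finS.
have [|a2 [wa2 a2tau] a2min] := finite_below_argmin finH.
  have [//|H0] := pselect (H !=set0); case: infW.
  apply: sub_finite_set (finS tau) => a wa; split; first exact: wS.
  by rewrite /= leNgt; apply/negP => ?; apply: H0; exists a.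
pose E := [set a | H a /\ wt omega a <= wt omega a2].
pose Delta := [set d | face d /\ wt omega d <= wt omega d1].
have [||||a [d [[[wa atau] a_le] [[Xd do0] d_le] uniq_ad]]] := @unique_sum n E Delta.
- exact: finH.
- by apply: sub_finite_set (finX (wt omega0 d0)) => d [].
- by exists a2.
- by exists d1.
have Sa := wS _ wa; have [_ /andP[ta at_]] := wa.
have [||a' [d' [Sa' Xd' ad' d'd]]] := no_single (a := a) (d := d) Sa.
- by move=> /uP; lra.
- apply: (wt_argmin_minimal pos0) => // d' Xd'.
  by apply: le_trans do0 _; exact: d0min.
case: d'd.
have Eo : wt omega a' + wt omega d' = wt omega a + wt omega d by rewrite -!wtD ad'.
have Eo0 : wt omega0 a' + wt omega0 d' = wt omega0 a + wt omega0 d.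
  by rewrite -!wtD ad'.
have a_far : tau + W < wt omega a.
  by rewrite ltNge; apply/negP => ?; apply: none; exists a; rewrite // atau.
have d1d := d1min _ (conj Xd do0).
have ta' : t <= wt omega0 a'.
  rewrite leNgt; apply/negP => a't; have := Sc _ Sa' => ca'.
  have /gP : [set p.1 + p.2 | p in [set a | S a /\ wt omega0 a < t] `*`
      [set d | X d /\ wt omega0 d <= t + delta + wt omega0 d0 + wt omega0 b]] (a' + d').
    by exists (a', d') => //; split=> //=; split=> //; lra.
  by rewrite ad' wtD; move: d1d => /=; lra.
(* As [a] lies in a window of width [delta] and [a'] is not below it, [d'] is less than [delta]
   above the minimum, hence on the face. *)
have d'o0 : wt omega0 d' <= wt omega0 d0 by apply: gap => //; lra.
have d0d' := d0min _ Xd'.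
have := vP _ (conj Xd' d'o0); have := d1min _ (conj Xd' d'o0) => /= d1d' vd'.
(* Exchanging [d] for [d'] lowers [omega] by at most [W], and [a] lies beyond [tau + W]. *)
have Ha' : H a'.
  split; last by lra.
  by split=> //; apply/andP; split=> //; lra.
have := a2min _ Ha' => a2a'.
have [||_ -> //] := uniq_ad a' d' _ _ ad'; split=> //=; lra.
Qed.

End Gaps.

(** * The gap theorem *)

(** Moving [omega] by [r / 2] either way along a coordinate axis stays in the dual cone; pair the
    results with [u]. *)
Lemma interior_dual_coercive {R : realType} {n} (sigma : set 'rV[R]_n)
    (omega : 'rV[R]_n) : interior (dual_cone sigma) omega ->
  exists2 e, 0 < e &
    forall u, sigma u -> forall i, e * `|u 0 i| <= dot omega u.
Proof.
move=> /nbhs_ballP[r /= r0 rP]; exists (r / 2); first by rewrite divr_gt0.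
have shift (c : R) i u : `|c| < r -> sigma u -> 0 <= dot omega u + c * u 0 i.
  move=> cr su; have /(_ u su) : dual_cone sigma (omega + c *: delta_mx 0 i).
    apply: rP; split=> // k j; rewrite /ball /= !mxE opprD addrA subrr add0r.
    rewrite normrN normrM.
    rewrite normr_nat; apply: le_lt_trans cr.
    by rewrite ler_piMr // lern1 leq_b1.
  congr (_ <= _); rewrite /dot; under eq_bigr do rewrite !mxE mulrDl.
  rewrite big_split /=; congr (_ + _); rewrite (bigD1 i) //= big1 ?addr0.
    by rewrite ?eqxx mulr1.
  by move=> j ji; rewrite (negPf ji) ?andbF mulr0 mul0r.
move=> u su i.
have r2 : `|r / 2| < r by rewrite ger0_norm ?divr_ge0 ?(ltW r0) //; lra.
have := shift _ i u r2 su; have := shift (- (r / 2)) i u; rewrite normrN.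
move=> /(_ r2 su); case: (ler0P (u 0 i)); lra.
Qed.

(** Split off integer roots one by one; characteristic zero keeps distinct integers distinct in
    [K]. *)
Lemma int_roots_bounded {K : fieldType} (q : {poly K}) :
  [pchar K] =i pred0 -> q != 0 ->
  exists B : int, forall z : int, root q z%:~R -> z <= B.
Proof.
move=> charK; have [m] := ubnP (size q); elim: m q => // m IHm q.
rewrite ltnS => qm q0.
have [[z0 qz0]|none] := pselect (exists z : int, root q z%:~R); last first.
  by exists 0 => z qz; case: none; exists z.
have /factor_theorem[q' Eq] := qz0.
have q'0 : q' != 0 by apply: contra_neq q0 => q'0; rewrite Eq q'0 mul0r.
have [|B BP] := IHm q' _ q'0.
  by move: qm; rewrite Eq size_Mmonic ?monicXsubC // size_XsubC addn2.
exists (Num.max z0 B) => z; rewrite Eq rootM root_XsubC => /orP[/BP zB|].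
  by rewrite le_max zB orbT.
rewrite -subr_eq0 -intrB => /eqP z0z.
suff -> : z = z0 by rewrite le_max lexx.
apply: subr0_eq; case: (z - z0) z0z => k /eqP.
  by rewrite -pmulrn (pcharf0P K).1 // => /eqP ->.
by rewrite NegzE mulrNz oppr_eq0 -pmulrn (pcharf0P K).1.
Qed.

Section IntegerWeight.
Context {R : realType} {n : nat} (sigma : set 'rV[R]_n) (omega : 'rV[R]_n).

Lemma wt_int_dot (lam a : 'rV[int]_n) :
  wt (int_vec lam : 'rV[R]_n) a = (int_dot lam a)%:~R.
Proof.
rewrite wtE /int_dot rmorph_sum; apply: eq_bigr => i _.
by rewrite mxE rmorphM.
Qed.

(** Eigenvalues must be integers, so a large multiple of [omega] is rounded down. *)
Lemma integer_dominating_weight (e : R) : 0 < e ->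
  (forall u, sigma u -> forall i, e * `|u 0 i| <= dot omega u) ->
  (forall i, 0 <= omega 0 i) ->
  exists lam : 'rV[int]_n, forall a, sigma (int_vec a) ->
    wt omega a <= (int_dot lam a)%:~R.
Proof.
(* Rounding changes each entry by at most 1, costing at most [n * wt omega a / e] in total; the
   final [+ 1] leaves [wt omega a]. *)
move=> e0 eP o0; pose N : R := n%:R / e + 1.
have N0 : 0 <= N by rewrite addr_ge0 // divr_ge0 // ltW.
exists (\row_i (Num.truncn (N * omega 0 i))%:Z) => a sa.
rewrite -wt_int_dot; set lam := int_vec _.
have -> : lam = N *: omega + (lam - N *: omega) by rewrite addrC subrK.
rewrite wtDl wtZl.
have : - (n%:R * (wt omega a / e)) <= wt (lam - N *: omega) a.
  have -> : n%:R * (wt omega a / e) = \sum_(i < n) wt omega a / e.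
    by rewrite sumr_const card_ord mulr_natl.
  rewrite [wt (lam - _) a]wtE -sumrN; apply: ler_sum => i _.
  have ai := eP _ sa i; rewrite mxE mulrC -ler_pdivlMr // -/(wt omega a) in ai.
  rewrite lerNl -mulNr; apply: le_trans ai; apply: le_trans (ler_norm _) _.
  rewrite normrM normrN ler_piMl // !mxE.
  have := truncn_le (N * omega 0 i); have := truncnS_gt (N * omega 0 i).
  rewrite mulr_ge0 // => lt1 le1; rewrite ler_norml -natr1 -pmulrn in lt1 le1 *.
  lra.
have -> : N * wt omega a = n%:R * (wt omega a / e) + wt omega a.
  by rewrite /N; field; rewrite gt_eqF.
lra.
Qed.

End IntegerWeight.

(** Bounded integer roots bound [int_dot lam a], which dominates [omega] up to the shift by [g];
    finiteness below then applies. *)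
Lemma finite_exceptional {R : realType} {K : fieldType} {n}
    (omega : 'rV[R]_n) (S X : set 'rV[int]_n) (chi : 'rV[int]_n -> {poly K})
    (lam g : 'rV[int]_n) :
  [pchar K] =i pred0 -> finite_below omega S ->
  (forall a, S a -> wt omega (a - g) <= (int_dot lam (a - g))%:~R) ->
  finite_set X -> (forall d, X d -> chi d != 0) ->
  finite_set [set a | S a /\ exists2 d, X d & root (chi d) (int_dot lam a)%:~R].
Proof.
move=> charK finS lamS finX chi0.
apply: (@sub_finite_set _ _ (\bigcup_(d in X)
    [set a | S a /\ root (chi d) (int_dot lam a)%:~R])).
  by move=> a [Sa [d Xd ra]]; exists d.
apply: bigcup_finite => // d Xd.
have [B BP] := int_roots_bounded charK (chi0 _ Xd).
apply: sub_finite_set (finS (wt omega g + (B - int_dot lam g)%:~R)) => a [Sa /BP aB].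
split=> //=; have := lamS _ Sa; rewrite wtB lerBlDl => /le_trans; apply.
by rewrite lerD2l ler_int -lerBDr opprK -int_dotD subrK.
Qed.

Unset Implicit Arguments.

Theorem theorem6p4 (R : realType) (K : fieldType) (charK : [pchar K] =i pred0)
    (n : nat) (sigma : set 'rV[R]_n)
    (sigma_rational : rational_cone sigma)
    (sigma_strongly_convex : strongly_convex sigma)
    (orthant_sigma : orthant R n `<=` sigma)
    (xi : laurent K n)
    (xi_sigma : cone_series_loc sigma xi)
    (xi_not_power : ~ cone_series_loc (orthant R n) xi)
    (xi_algebraic : algebraic_over_power_series R xi)
    (omega : 'rV[R]_n) (omega_dual : interior (dual_cone sigma) omega)
    (k : nat -> R) (k_expansion : weight_expansion omega xi k) :
  exists2 C : R, 0 < C & forall i : nat, k i.+1 <= k i + C.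
Proof.
have [e e0 eP] := interior_dual_coercive omega_dual.
have [g gP] := xi_sigma.
(* The basis vectors lie in [sigma], so coercivity gives [e] as a lower bound for each entry. *)
have omega0 : positive omega.
  move=> i; have /eP/(_ i) : sigma (int_vec (delta_mx 0 i)).
    by apply/orthant_sigma/orthant_int_vec => j; rewrite mxE; case: (_ && _).
  rewrite -/(wt omega _) wtE (bigD1 i) //= big1 => [|j ji]; rewrite !mxE ?eqxx /=.
    by rewrite addr0 normr1 !mulr1; apply: lt_le_trans.
  by rewrite (negPf ji) mulr0.
(* Translating the support by [g] changes the coercivity estimate by a constant only. *)
have finS : finite_below omega (supp xi).
  apply: (@finite_below_coercive _ _ _ _ e
    (\sum_i e * `|(g 0 i)%:~R| - wt omega g)) => // a xa i.
  have := eP _ (gP _ xa) i; rewrite -/(wt omega _) wtB !mxE intrB => egi.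
  have : e * `|(g 0 i)%:~R| <= \sum_i e * `|(g 0 i)%:~R|.
    rewrite [leRHS](bigD1 i) //= lerDl sumr_ge0 // => j _.
    by rewrite mulr_ge0 // ltW.
  have : e * `|(a 0 i)%:~R| <=
      e * `|(a 0 i)%:~R - (g 0 i)%:~R| + e * `|(g 0 i)%:~R|.
    by rewrite -mulrDr ler_pM2l // -{1}(subrK (g 0 i)%:~R (a 0 i)%:~R) ler_normD.
  by lra.
have [|lam lamP] := integer_dominating_weight e0 eP.
  by move=> i; exact: ltW.
have [chi [chi_neq0 chi_nonneg chiP]] :=
  algebraic_recurrence lam charK omega0 finS xi_algebraic.
pose X := [set d | chi d != 0].
have X0 : X `<=` nonneg by move=> d; exact: chi_nonneg.
have finF := finite_exceptional charK finS
  (fun a xa => lamP _ (gP a xa)) (finite_minimal_in X0) (fun d Xd => proj1 Xd).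
have [||W [T [W0 gaps]]] := bounded_gaps X0 chi_neq0 finF _ omega0 finS.
- move=> a d xa nF Md; have [//|none] := pselect (exists a' d',
    [/\ supp xi a', X d', a' + d' = a + d & d' <> d]).
  case: nF; split=> //; exists d => //; apply: chiP xa => a' d' xa' Xd' ad'.
  have [//|d'd] := pselect (d' = d).
  by case: none; exists a', d'.
- move=> [b bP]; apply: xi_not_power; exists (- b) => a /bP.
  by rewrite opprK => ?; apply/orthant_int_vec.
have [k_sum _ k_incr k_part] := k_expansion.
have supp_wt a : supp xi a -> exists j, wt omega a = k j.
  move=> xa; have [//|none] := pselect (exists j, wt omega a = k j).
  case/eqP: xa; rewrite k_sum fsbig1 // => j _; rewrite /weight_part.
  by case: eqP => // ka; case: none; exists j.
have k_next i a : supp xi a -> k i < wt omega a -> k i.+1 <= wt omega a.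
  move=> /supp_wt[j ->] kij; rewrite leNgt; apply/negP => kji.
  have [ji|ij|ij] := ltngtP j i.
  - by have := lt_trans kij (k_incr _ _ ji); rewrite ltxx.
  - have [ij'|ji] := ltnP i.+1 j.
      by have := lt_trans kji (k_incr _ _ ij'); rewrite ltxx.
    have Ej : j = i.+1 by apply/eqP; rewrite eqn_leq ji ij.
    by rewrite Ej ltxx in kji.
  by rewrite ij ltxx in kij.
have k_le i j : (i <= j)%N -> k i <= k j.
  by rewrite leq_eqVlt => /orP[/eqP ->|/k_incr/ltW].
have [i0 Ti0] : exists i0, T <= k i0.
  have [a xa /andP[Ta _]] := gaps T (lexx T).
  by have [j aj] := supp_wt _ xa; exists j; rewrite -aj ltW.
(* [W] covers the gaps from [i0] on; [k i0 - k 0] covers all earlier ones at once. *)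
exists (W + (k i0 - k 0%N)) => [|i]; first by rewrite ltr_wpDr // subr_ge0 k_le.
have [ii0|i0i] := ltnP i i0.
  by have := k_le _ _ ii0; have := k_le _ _ (leq0n i); lra.
have [a xa /andP[ka aW]] := gaps (k i) (le_trans Ti0 (k_le _ _ i0i)).
by have := k_next _ _ xa ka; have := k_le _ _ (leq0n i0); lra.
Qed.
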